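(* Let $\mathcal T$ be a tiling of an integral zonotope $Z\subset N_{\mathbb R}$. The $\mathbb G_m$-variety $Y(\mathcal T)$ has non-negative weights if and only if $0\in Z$, and it has positive weights if and only if $0$ is contained in the interior of $Z$.
   Context: Fix an algebraically closed field $k$. Let $N$ be a lattice (free abelian group of finite rank), $N^*=\mathrm{Hom}(N,\mathbb Z)$, $N_{\mathbb R}=N\otimes\mathbb R$, and let $T=\mathrm{Spec}\,k[N^*]$ be the torus over $k$ with cocharacter lattice $\mathrm{Hom}(\mathbb G_m,T)\cong N$. ''Interior'' means interior in $N_{\mathbb R}$. A $\mathbb G_m$-variety $Y$ has non-negative weights if the induced grading of $k[Y]$ is non-negative, and positive weights if in addition the degree zero piece of $k[Y]$ consists only of constant functions. (The grading is normalized so that the coordinates $z_e,w_e$ below have degree $1$ for the $\mathbb G_m$-factor.) Zonotopes. For a finite set $E$, $\mathbf a\in N^E$ and a sign vector $u\in\{+,-,0\}^E$, put $Z(\mathbf a)=\sum_{e\in E}[-1,1]\cdot\mathbf a_e\subset N_{\mathbb R}$ and $Z(\mathbf a,u)=\sum_{u_e=0}[-1,1]\cdot\mathbf a_e+\sum_{u_e=+}\mathbf a_e-\sum_{u_e=-}\mathbf a_e$. An integral zonotope is a set of the form $Z(\mathbf a)+\eta$ with $\eta\in N$. Faces are nonempty, and a zonotope is a face of itself. We call $\mathbf a$ a primitive spanning configuration if every $\mathbf a_e$ is a nonzero primitive vector and $\mathbf a$ spans $N_{\mathbb R}$. Every integral zonotope equals $Z(\mathbf a,u)$ for some primitive spanning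 $\mathbf a$ and some $u$. Affine varieties. Let $S(E)=\mathrm{Spec}\,k[z_e,w_e]_{e\in E}$ with symplectic form $\sum_e dz_e\wedge dw_e$. The group $\mathbb G_m^E\times\mathbb G_m$ acts by $(t,s)\cdot z_e=t_e^{-1}sz_e$, $(t,s)\cdot w_e=t_esw_e$, and $\mu_E=(z_ew_e)_{e\in E}:S(E)\to\mathrm{Lie}(\mathbb G_m^E)^*$ is a moment map for $\mathbb G_m^E$. Let $\mathbf a\in N^E$ be a primitive spanning configuration, $K$ the kernel of the homomorphism $\mathbb G_m^E\to T$ induced by $\mathbf a$, and $\mu_{\mathbf a}$ the composition of $\mu_E$ with $\mathrm{Lie}(\mathbb G_m^E)^*\to\mathrm{Lie}(K)^*$. For $u\in\{+,-,0\}^E$ let $f_u=\prod_{u_e=+}z_e\prod_{u_e=-}w_e$ and let $S(E)_u\subset S(E)$ be the locus $f_u\ne0$. Define $Y(\mathbf a,u)=\mathrm{Spec}\,k[S(E)_u\cap\mu_{\mathbf a}^{-1}(0)]^K$. It inherits an action of $T\times\mathbb G_m$ and a Poisson bracket. Up to isomorphism of Poisson $T\times\mathbb G_m$-varieties it depends only on $Z=Z(\mathbf a,u)$, and is denoted $Y(Z)$. Tilings. A tiling of an integral zonotope $Z$ is a set $\mathcal T$ of integral zonotopes with $Z=\bigcup_{F\in\mathcal T}F$, such that every face of an element of $\mathcal T$ is in $\mathcal T$, and such that if $F,F'\in\mathcal T$ and $F\cap F'\neq\emptyset$ then $F\cap F'$ is a face of both. Given $\mathbf a$ and $u$ with $Z=Z(\mathbf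 a,u)$, let $E_u=\{e:u_e=0\}$, let $\bar{\mathbf a}$ be the restriction of $\mathbf a$ to $E_u$, and let $\mathcal V^*(\bar{\mathbf a})=\{(\mathrm{sign}\,m(\bar{\mathbf a}_e))_{e\in E_u}:m\in N^*\}$. An affine oriented matroid over $\mathcal V^*(\bar{\mathbf a})$ is a set $\mathcal M\subset\{+,-,0\}^{E_u\sqcup\{\infty\}}$ satisfying the covector axioms of an oriented matroid and such that $(v,0)\in\mathcal M$ iff $v\in\mathcal V^*(\bar{\mathbf a})$ (the last coordinate being the one indexed by $\infty$). Put $\mathcal M_+=\{v:(v,+)\in\mathcal M\}$. For $v\in\{+,-,0\}^{E_u}$ let $\hat v\in\{+,-,0\}^E$ agree with $v$ on $E_u$ and with $u$ off $E_u$. By the Bohne–Dress theorem every tiling of $Z(\mathbf a,u)$ has the form $\mathcal T(\mathbf a,u,\mathcal M)=\{Z(\mathbf a,\hat v):v\in\mathcal M_+\}$. Let $S(E)_{u,\mathcal M}=\bigcup_{v\in\mathcal M_+}S(E)_{\hat v}$ and let $Y(\mathbf a,u,\mathcal M)$ be the categorical quotient of $S(E)_{u,\mathcal M}\cap\mu_{\mathbf a}^{-1}(0)$ by $K$, with the induced $T\times\mathbb G_m$-action, Poisson structure, and map to $Y(\mathbf a,u)=Y(Z)$. This depends only on $\mathcal T=\mathcal T(\mathbf a,u,\mathcal M)$ up to isomorphism of Poisson $T\times\mathbb G_m$-varieties over $Y(Z)$, and is denoted $Y(\mathcal T)$. *)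

(* Defs.v *)
From HB Require Import structures.
From mathcomp Require Import all_boot all_order all_algebra.
From mathcomp Require Import boolp classical_sets reals.

Set Implicit Arguments.
Unset Strict Implicit.
Unset Printing Implicit Defensive.

Import Order.TTheory GRing.Theory Num.Theory.
Local Open Scope classical_set_scope.
Local Open Scope ring_scope.

(** * Schemes over a field, as functors of points

    A k-scheme is a functor from commutative k-algebras to types that is a
    Zariski sheaf and is covered by open affine subfunctors (Demazure-Gabriel).
    [comAlgType k] contains exactly the nonzero commutative k-algebras; the
    value of a sheaf at the zero algebra is always a point, so leaving it out
    loses nothing. *)

Record kfunctor (k : fieldType) := KFunctor {
  points :> comAlgType k -> Type;
  kmap : forall A B : comAlgType k,
    {lrmorphism A -> B} -> points A -> points B;
  kmap_id : forall (A : comAlgType k) (x : points A),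
    kmap (idfun : {lrmorphism A -> A}) x = x;
  kmap_comp : forall (A B C : comAlgType k)
    (g : {lrmorphism B -> C}) (f : {lrmorphism A -> B}) (x : points A),
    kmap (g \o f : {lrmorphism A -> C}) x = kmap g (kmap f x)
}.

Record kmor (k : fieldType) (F G : kfunctor k) := KMor {
  mor :> forall A : comAlgType k, F A -> G A;
  mor_nat : forall (A B : comAlgType k) (f : {lrmorphism A -> B}) (x : F A),
    mor (kmap f x) = kmap f (mor x)
}.

Definition unit_ideal (A : comNzRingType) (I : set A) : Prop :=
  exists (n : nat) (c f : 'I_n -> A),
    (forall i, I (f i)) /\ \sum_(i < n) c i * f i = 1.

Definition is_localization (A B : comNzRingType) (a : A)
    (phi : {rmorphism A -> B}) : Prop :=
  [/\ exists b, phi a * b = 1,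
      forall b, exists (n : nat) (x : A), phi a ^+ n * b = phi x
    & forall x, phi x = 0 -> exists n : nat, a ^+ n * x = 0].

(** Agreement on the overlaps Spec (B i ⊗_A B j) is tested on all algebras
    mapping to them, i.e. on all commutative squares under A. *)
Definition zariski_sheaf (k : fieldType) (F : kfunctor k) : Prop :=
  forall (A : comAlgType k) (n : nat) (a : 'I_n -> A)
    (B : 'I_n -> comAlgType k) (phi : forall i, {lrmorphism A -> B i}),
    unit_ideal (range a) ->
    (forall i, is_localization (a i) (phi i)) ->
    forall s : forall i, F (B i),
    (forall (i j : 'I_n) (C : comAlgType k)
       (f : {lrmorphism B i -> C}) (g : {lrmorphism B j -> C}),
       (forall x, f (phi i x) = g (phi j x)) ->
       kmap f (s i) = kmap g (s j)) ->
    exists! s0 : F A, forall i, kmap (phi i) s0 = s i.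

(** The pullback of U along every A-point is the open subscheme of Spec A
    where the elements of I generate the unit ideal. *)
Definition open_subfunctor (k : fieldType) (F : kfunctor k)
    (U : forall A : comAlgType k, F A -> Prop) : Prop :=
  forall (A : comAlgType k) (x : F A), exists I : set A,
  forall (B : comAlgType k) (f : {lrmorphism A -> B}),
    U B (kmap f x) <-> unit_ideal (f @` I).

(** U is represented by A with universal element x. *)
Definition affine_subfunctor (k : fieldType) (F : kfunctor k)
    (U : forall A : comAlgType k, F A -> Prop) : Prop :=
  exists (A : comAlgType k) (x : F A),
    U A x /\
    forall (B : comAlgType k) (y : F B), U B y ->
    exists f : {lrmorphism A -> B},
      kmap f x = y /\
      forall g : {lrmorphism A -> B}, kmap g x = y -> g =1 f.

Definition is_scheme (k : fieldType) (F : kfunctor k) : Prop :=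
  zariski_sheaf F /\
  forall (K : comAlgType k), (forall a : K, a != 0 -> exists b, a * b = 1) ->
  forall x : F K, exists U : forall A : comAlgType k, F A -> Prop,
    [/\ open_subfunctor U, affine_subfunctor U & U K x].

Definition A1_fmap (k : fieldType) (A B : comAlgType k)
  (f : {lrmorphism A -> B}) (x : A) : B := f x.

Definition A1 (k : fieldType) : kfunctor k :=
  @KFunctor k (fun A => A) (@A1_fmap k)
    (fun A x => erefl) (fun A B C g f x => erefl).

(** The ring of functions k[Y]. *)
Definition global_functions (k : fieldType) (Y : kfunctor k) := kmor Y (A1 k).

Definition invariant (k : fieldType) (G : comAlgType k -> Type)
    (X : kfunctor k) (act : forall A : comAlgType k, G A -> X A -> X A)
    (W : kfunctor k) (g : kmor X W) : Prop :=
  forall (A : comAlgType k) (t : G A) (x : X A), g A (act A t x) = g A x.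

Definition categorical_quotient (k : fieldType) (G : comAlgType k -> Type)
    (X : kfunctor k) (act : forall A : comAlgType k, G A -> X A -> X A)
    (Y : kfunctor k) (pi : kmor X Y) : Prop :=
  [/\ is_scheme Y, invariant act pi
    & forall (W : kfunctor k) (g : kmor X W), is_scheme W -> invariant act g ->
      exists h : kmor Y W,
        (forall A x, h A (pi A x) = g A x) /\
        forall h' : kmor Y W, (forall A x, h' A (pi A x) = g A x) ->
          forall A y, h' A y = h A y].

(** * The multiplicative group and weights *)

(** Points of G_m; the inverse is carried along because a [comAlgType] has no
    inversion operation. *)
Record Gm (A : comNzRingType) := MkGm {
  gval : A;
  ginv : A;
  gvalK : gval * ginv = 1
}.

Definition gm1 (A : comNzRingType) : Gm A := MkGm (mulr1 (1 : A)).

Lemma gm_mulK (A : comNzRingType) (s t : Gm A) :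
  (gval s * gval t) * (ginv s * ginv t) = 1.
Proof. by rewrite mulrACA !gvalK mulr1. Qed.

Definition gm_mul (A : comNzRingType) (s t : Gm A) : Gm A :=
  MkGm (gm_mulK s t).

Lemma gm_mapK (A B : comNzRingType) (f : {rmorphism A -> B}) (s : Gm A) :
  f (gval s) * f (ginv s) = 1.
Proof. by rewrite -rmorphM gvalK rmorph1. Qed.

Definition gm_map (A B : comNzRingType) (f : {rmorphism A -> B}) (s : Gm A) :
  Gm B := MkGm (gm_mapK f s).

Definition gm_pow (A : comNzRingType) (s : Gm A) (d : int) : A :=
  match d with Posz n => gval s ^+ n | Negz n => ginv s ^+ n.+1 end.

Record gm_action (k : fieldType) (Y : kfunctor k) := GmAction {
  gact :> forall A : comAlgType k, Gm A -> Y A -> Y A;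
  gact_nat : forall (A B : comAlgType k) (f : {lrmorphism A -> B})
    (s : Gm A) (y : Y A),
    kmap f (gact s y) = gact (gm_map f s) (kmap f y);
  gact1 : forall (A : comAlgType k) (y : Y A), gact (gm1 A) y = y;
  gactM : forall (A : comAlgType k) (s t : Gm A) (y : Y A),
    gact (gm_mul s t) y = gact s (gact t y)
}.

(** The degree d piece of the grading of k[Y]. *)
Definition has_weight (k : fieldType) (Y : kfunctor k) (rho : gm_action Y)
    (d : int) (f : global_functions Y) : Prop :=
  forall (A : comAlgType k) (s : Gm A) (y : Y A),
    f A (rho A s y) = gm_pow s d * f A y.

Definition nonneg_weights (k : fieldType) (Y : kfunctor k)
    (rho : gm_action Y) : Prop :=
  forall d : int, d < 0 -> forall f : global_functions Y,
    has_weight rho d f -> forall A y, f A y = 0.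

Definition positive_weights (k : fieldType) (Y : kfunctor k)
    (rho : gm_action Y) : Prop :=
  nonneg_weights rho /\
  forall f : global_functions Y, has_weight rho 0 f ->
    exists c : k, forall A y, f A y = c%:A.

(** * Signs and oriented matroids *)

Inductive sign := SPos | SNeg | SZero.

Definition is_zero (s : sign) : bool := if s is SZero then true else false.

Definition sign_of (x : int) : sign :=
  if x == 0 then SZero else if 0 < x then SPos else SNeg.

Definition sign_opp (s : sign) : sign :=
  match s with SPos => SNeg | SNeg => SPos | SZero => SZero end.

Definition sign_comp (s t : sign) : sign := if s is SZero then t else s.

Definition separates (I : Type) (v w : I -> sign) (e : I) : Prop :=
  v e <> SZero /\ v e = sign_opp (w e).

Record covector_axioms (I : Type) (M : set (I -> sign)) : Prop := {
  covector0 : M (fun=> SZero);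
  covectorN : forall v, M v -> M (fun e => sign_opp (v e));
  covector_comp : forall v w, M v -> M w ->
    M (fun e => sign_comp (v e) (w e));
  covector_elim : forall v w e, M v -> M w -> separates v w e ->
    exists x, [/\ M x, x e = SZero
      & forall e', ~ separates v w e' -> x e' = sign_comp (v e') (w e')]
}.

(** * Zonotopes and tilings

    The lattice N is Z^n (row vectors), and N^* consists of column vectors. *)

Definition pairing (n : nat) (m : 'cV[int]_n) (b : 'rV[int]_n) : int :=
  (b *m m) 0 0.

Definition toNR (R : realType) (n : nat) (b : 'rV[int]_n) : 'rV[R]_n :=
  map_mx intr b.

Definition zonotope (R : realType) (n : nat) (E : finType)
    (a : E -> 'rV[int]_n) (u : E -> sign) : set 'rV[R]_n :=
  [set x | exists c : E -> R,
    (forall e, match u e with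
               | SPos => c e = 1
               | SNeg => c e = -1
               | SZero => -1 <= c e <= 1
               end) /\
    x = \sum_e c e *: toNR R (a e)].

Definition integral_zonotope (R : realType) (n : nat) (Z : set 'rV[R]_n) :
    Prop :=
  exists (E : finType) (a : E -> 'rV[int]_n) (eta : 'rV[int]_n),
    Z = [set x + toNR R eta | x in zonotope a (fun=> SZero)].

Definition primitive (n : nat) (b : 'rV[int]_n) : Prop :=
  b <> 0 /\
  forall (d : int) (b' : 'rV[int]_n), b = d *: b' -> d = 1 \/ d = -1.

Definition primitive_spanning (R : realType) (n : nat) (E : finType)
    (a : E -> 'rV[int]_n) : Prop :=
  (forall e, primitive (a e)) /\
  forall x : 'rV[R]_n, exists c : E -> R, x = \sum_e c e *: toNR R (a e).

Definition face (R : realType) (n : nat) (F P : set 'rV[R]_n) : Prop :=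
  F !=set0 /\
  exists c : 'cV[R]_n,
    F = [set x | P x /\ forall y, P y -> (y *m c) 0 0 <= (x *m c) 0 0].

Record tiling (R : realType) (n : nat) (Z : set 'rV[R]_n)
    (T : set (set 'rV[R]_n)) : Prop := {
  tiling_zonotope : forall F, T F -> integral_zonotope F;
  tiling_cover : Z = \bigcup_(F in T) F;
  tiling_face : forall F F', T F -> face F' F -> T F';
  tiling_meet : forall F F', T F -> T F' -> F `&` F' !=set0 ->
    face (F `&` F') F /\ face (F `&` F') F'
}.

(** The set E_u. *)
Definition zero_part (E : finType) (u : E -> sign) := {e : E | is_zero (u e)}.

Definition vector_covectors (n : nat) (I : Type) (a : I -> 'rV[int]_n) :
    set (I -> sign) :=
  [set v | exists m : 'cV[int]_n, v = fun e => sign_of (pairing m (a e))].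

(** The element [None] of [option I] plays the role of infinity. *)
Definition extend_sign (I : Type) (v : I -> sign) (s : sign) :
    option I -> sign :=
  fun e => if e is Some e' then v e' else s.

Definition affine_oriented_matroid (n : nat) (I : Type)
    (a : I -> 'rV[int]_n) (M : set (option I -> sign)) : Prop :=
  covector_axioms M /\
  forall v, M (extend_sign v SZero) <-> vector_covectors a v.

Definition positive_part (I : Type) (M : set (option I -> sign)) :
    set (I -> sign) :=
  [set v | M (extend_sign v SPos)].

Definition hat (E : finType) (u : E -> sign) (v : zero_part u -> sign) :
    E -> sign :=
  fun e => if insub e is Some e' then v e' else u e.

Definition zonotope_tiling (R : realType) (n : nat) (E : finType)
    (a : E -> 'rV[int]_n) (u : E -> sign)
    (M : set (option (zero_part u) -> sign)) : set (set 'rV[R]_n) :=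
  [set zonotope a (hat v) | v in positive_part M].

(** * The variety Y(a,u,M) *)

(** A-points of S(E): the coordinates (z, w). *)
Definition S_points (E : finType) (A : comNzRingType) : Type :=
  ((E -> A) * (E -> A))%type.

(** The homomorphism G_m^E -> T = Hom(N^*, G_m) induced by a. *)
Definition torus_hom (n : nat) (E : finType) (a : E -> 'rV[int]_n)
    (A : comNzRingType) (t : E -> Gm A) (m : 'cV[int]_n) : A :=
  \prod_e gm_pow (t e) (pairing m (a e)).

Definition Kgroup (n : nat) (E : finType) (a : E -> 'rV[int]_n)
    (A : comNzRingType) : Type :=
  {t : E -> Gm A | forall m, torus_hom a t m = 1}.

(** Lie(K) is the kernel of the differential k^E -> N ⊗ k. *)
Definition LieK (k : fieldType) (n : nat) (E : finType)
    (a : E -> 'rV[int]_n) (c : E -> k) : Prop :=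
  forall m : 'cV[int]_n, \sum_e (pairing m (a e))%:~R * c e = 0.

(** mu_a(z, w) = 0 as an element of Lie(K)^* ⊗ A. *)
Definition moment_zero (k : fieldType) (n : nat) (E : finType)
    (a : E -> 'rV[int]_n) (A : comAlgType k) (x : S_points E A) : Prop :=
  forall c : E -> k, LieK a c -> \sum_e c e *: (x.1 e * x.2 e) = 0.

Definition sign_monomial (E : finType) (A : comNzRingType) (u : E -> sign)
    (x : S_points E A) : A :=
  \prod_e match u e with SPos => x.1 e | SNeg => x.2 e | SZero => 1 end.

(** An A-point of S(E) lies in the open subscheme S(E)_{u,M}, the union of the
    loci f_v <> 0, iff the f_v generate the unit ideal of A. *)
Definition in_XM (k : fieldType) (n : nat) (E : finType)
    (a : E -> 'rV[int]_n) (u : E -> sign)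
    (M : set (option (zero_part u) -> sign))
    (A : comAlgType k) (x : S_points E A) : Prop :=
  moment_zero a x /\
  unit_ideal [set sign_monomial (hat v) x | v in positive_part M].

Section XM.
Context (k : fieldType) (n : nat) (E : finType) (a : E -> 'rV[int]_n).
Context (u : E -> sign) (M : set (option (zero_part u) -> sign)).

Definition S_map (A B : comAlgType k) (f : {lrmorphism A -> B})
    (x : S_points E A) : S_points E B :=
  (fun e => f (x.1 e), fun e => f (x.2 e)).

Lemma S_map_in (A B : comAlgType k) (f : {lrmorphism A -> B}) x :
  in_XM a M x -> in_XM a M (S_map f x).
Proof.
case=> hmu [r [c [g [hg hsum]]]]; split=> [d hd|].
  transitivity (f (\sum_e d e *: (x.1 e * x.2 e))); last by rewrite hmu ?rmorph0.
  by rewrite rmorph_sum; apply: eq_bigr => e _ /=; rewrite linearZ rmorphM.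
exists r, (fun i => f (c i)), (fun i => f (g i)); split=> [i|]; last first.
  transitivity (f (\sum_i c i * g i)); last by rewrite hsum rmorph1.
  by rewrite rmorph_sum; apply: eq_bigr => i _; rewrite rmorphM.
have [v hv <-] := hg i; exists v => //.
rewrite /sign_monomial rmorph_prod; apply: eq_bigr => e _.
by case: (hat v e); rewrite ?rmorph1.
Qed.

Definition XM_map (A B : comAlgType k) (f : {lrmorphism A -> B})
    (x : {x : S_points E A | in_XM a M x}) : {x : S_points E B | in_XM a M x} :=
  exist _ (S_map f (sval x)) (S_map_in f (svalP x)).

Lemma XM_map_id (A : comAlgType k) x :
  XM_map (idfun : {lrmorphism A -> A}) x = x.
Proof. by case: x => -[z w] hx; exact: eq_exist. Qed.

Lemma XM_map_comp (A B C : comAlgType k)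
    (g : {lrmorphism B -> C}) (f : {lrmorphism A -> B}) x :
  XM_map (g \o f : {lrmorphism A -> C}) x = XM_map g (XM_map f x).
Proof. exact: eq_exist. Qed.

(** The scheme-theoretic intersection of S(E)_{u,M} and mu_a^{-1}(0). *)
Definition XM : kfunctor k := KFunctor XM_map_id XM_map_comp.

(** The action of G_m^E x G_m on points: z_e |-> t_e^{-1} s z_e and
    w_e |-> t_e s w_e. *)
Definition S_act (A : comAlgType k) (t : E -> Gm A) (s : Gm A)
    (x : S_points E A) : S_points E A :=
  (fun e => ginv (t e) * gval s * x.1 e, fun e => gval (t e) * gval s * x.2 e).

Lemma S_act_in (A : comAlgType k) (t : E -> Gm A) (s : Gm A) x :
  in_XM a M x -> in_XM a M (S_act t s x).
Proof.
case=> hmu [r [c [g [hg hsum]]]]; split=> [d hd|].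
  transitivity (\sum_e (gval s * gval s) * (d e *: (x.1 e * x.2 e))).
    apply: eq_bigr => e _ /=; rewrite -scalerAr; congr (_ *: _).
    rewrite (mulrACA _ (x.1 e)) (mulrACA (ginv _)).
    by rewrite [ginv _ * _]mulrC gvalK mul1r.
  by rewrite -mulr_sumr hmu // mulr0.
(* each sign monomial is multiplied by a unit *)
have hu (v : E -> sign) : exists q : A,
    q * sign_monomial v (S_act t s x) = sign_monomial v x.
  exists (\prod_e match v e with SPos => gval (t e) * ginv s
                    | SNeg => ginv (t e) * ginv s | SZero => 1 end).
  rewrite /sign_monomial -big_split; apply: eq_bigr => e _ /=.
  case: (v e); rewrite ?mulr1 // mulrA mulrACA.
  - by rewrite gvalK [ginv s * _]mulrC gvalK mulr1 mul1r.
  - by rewrite ![ginv _ * _]mulrC !gvalK mulr1 mul1r.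
have hv i : exists q : A * A, g i = q.1 * q.2 /\
    [set sign_monomial (hat v) (S_act t s x) | v in positive_part M] q.2.
  have [v Mv <-] := hg i; have [q <-] := hu (hat v).
  by exists (q, sign_monomial (hat v) (S_act t s x)); split=> //; exists v.
have [q hq] := choice hv.
exists r, (fun i => c i * (q i).1), (fun i => (q i).2); split=> [i|].
  by have [] := hq i.
by rewrite -hsum; apply: eq_bigr => i _; have [-> _] := hq i; rewrite mulrA.
Qed.

Definition XM_act (A : comAlgType k) (t : E -> Gm A) (s : Gm A) (x : XM A) :
  XM A := exist _ (S_act t s (sval x)) (S_act_in t s (svalP x)).

Definition XM_Kact (A : comAlgType k) (t : Kgroup a A) (x : XM A) : XM A :=
  XM_act (sval t) (gm1 A) x.

Definition XM_Gmact (A : comAlgType k) (s : Gm A) (x : XM A) : XM A :=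
  XM_act (fun=> gm1 A) s x.

(** Y, with G_m-action rho, is Y(a,u,M) with its induced action. *)
Definition is_Y_of_matroid (Y : kfunctor k) (rho : gm_action Y) : Prop :=
  exists pi : kmor XM Y,
    categorical_quotient XM_Kact pi /\
    forall (A : comAlgType k) (s : Gm A) (x : XM A),
      pi A (XM_Gmact s x) = rho A s (pi A x).

End XM.

(** Y, with G_m-action rho, is Y(T) for the tiling T of Z. *)
Definition is_Y_of_tiling (k : fieldType) (R : realType) (n : nat)
    (Z : set 'rV[R]_n) (T : set (set 'rV[R]_n))
    (Y : kfunctor k) (rho : gm_action Y) : Prop :=
  exists (E : finType) (a : E -> 'rV[int]_n) (u : E -> sign)
         (M : set (option (zero_part u) -> sign)),
    [/\ primitive_spanning R a,
        Z = zonotope a u,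
        affine_oriented_matroid (fun e : zero_part u => a (val e)) M,
        T = zonotope_tiling a M
      & is_Y_of_matroid a M rho].

(* Main.v *)
Require Import Defs.
From HB Require Import structures.
From mathcomp Require Import all_boot all_order all_algebra.
From mathcomp Require Import boolp classical_sets functions reals topology normedtype.
From mathcomp Require Import zify ring lra.

Set Implicit Arguments.
Unset Strict Implicit.
Unset Printing Implicit Defensive.

Import Order.TTheory GRing.Theory Num.Theory.
Import numFieldNormedType.Exports.
Local Open Scope classical_set_scope.
Local Open Scope ring_scope.

(** Let X be the open part [XM] of the zero fibre of the moment map, h the
    support function of Z on N^*, and q_e = m(a_e) for m in N^*.

    Since the affine line is a scheme ([A1_scheme]), functions on Y are the
    same as K-invariant functions on X ([pullback_inj], [descent]), and weights
    correspond.  For each m there is a K-invariant monomial on X, a product of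
    powers of z_e or w_e with exponents |q_e| or, where a coordinate is
    invertible, plus or minus q_e; it has weight h(m) ([monomial_weight]) and
    does not vanish at the generic points.  If 0 is not in Z, then linear
    programming duality over the rationals yields an integral m with h(m) < 0,
    and if 0 is in Z but not in its interior, a nonzero m with h(m) <= 0
    ([not_zonotope0_functional], [interior_or_functional]).  The monomial of m
    then has negative weight, or is a non-constant function of weight zero.

    Conversely, let f be a K-invariant homogeneous function on X.  A function
    on X is determined by its values at the generic points, those with all z_e
    and w_e nonzero ([vanish_density]).  Let Z(a,v) be a tile.  An integral c
    with |c_e| <= D, and c_e = D or - D according to the sign v_e where that is
    nonzero, defines a one-parameter subgroup (s^c, s^D) of G_m^E x G_m under
    which z_e and w_e have the weights D - c_e >= 0 and D + c_e >= 0, and those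
    coordinates that are invertible on the chart of the tile have weight zero.
    Hence the orbit of a generic point extends to s = 0 inside the chart, and f
    is a polynomial in s along it ([degeneration]).

    If 0 lies in the tile, then c can be taken with sum c_e a_e = 0, so that
    s^c lies in K.  Along the orbit f is then s^(D d) times a constant, where d
    is the weight of f; this is not a polynomial for d < 0 unless f = 0
    ([negative_weight_vanish]).

    If 0 is interior to Z and d = 0, then multiples of a_e and of - a_e lie in
    tiles.  Modulo K the two orbits move only the e-th torus coordinate, in
    opposite directions, so f is a polynomial in s and in 1/s, that is,
    constant along them ([generic_value_coord]).  So f is invariant under the
    whole torus G_m^E, and any two generic points have, up to this torus, a
    common limit in the chart of a tile; f is constant
    ([weight_zero_constant]). *)

(** * Commutative algebras *)

Section Algebras.
Variable k : fieldType.

(** An alias, because the same ring may carry several algebra structures: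
    {poly A} is canonically an algebra over A, and is needed over k. *)
Definition kalg (B : comNzRingType) (j : {rmorphism k -> B}) : Type := B.

Section Kalg.
Variables (B : comNzRingType) (j : {rmorphism k -> B}).
HB.instance Definition _ := GRing.ComNzRing.on (kalg j).

Definition kalg_scale (c : k) (x : kalg j) : kalg j := j c * (x : B).

Lemma kalg_scaleA c d x : kalg_scale c (kalg_scale d x) = kalg_scale (c * d) x.
Proof. by rewrite /kalg_scale mulrA rmorphM. Qed.
Lemma kalg_scale1 : left_id 1 kalg_scale.
Proof. by move=> x; rewrite /kalg_scale rmorph1 mul1r. Qed.
Lemma kalg_scaleDr : right_distributive kalg_scale +%R.
Proof. by move=> c x y; rewrite /kalg_scale mulrDr. Qed.
Lemma kalg_scaleDl x : {morph kalg_scale^~ x : c d / c + d}.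
Proof. by move=> c d; rewrite /kalg_scale rmorphD mulrDl. Qed.
HB.instance Definition _ := GRing.Zmodule_isLmodule.Build k (kalg j)
  kalg_scaleA kalg_scale1 kalg_scaleDr kalg_scaleDl.

Lemma kalg_scaleAl (c : k) (x y : kalg j) : c *: (x * y) = (c *: x) * y.
Proof. exact: mulrA. Qed.
HB.instance Definition _ := GRing.Lmodule_isLalgebra.Build k (kalg j) kalg_scaleAl.
HB.instance Definition _ := GRing.Lalgebra_isComAlgebra.Build k (kalg j).

Lemma kalgE (c : k) : c%:A = j c :> kalg j.
Proof. exact: mulr1. Qed.
End Kalg.

Lemma alg_morph_scalable (A B : comAlgType k) (g : {rmorphism A -> B}) :
  (forall c : k, g c%:A = c%:A) -> scalable g.
Proof. by move=> gk c x; rewrite -mulr_algl rmorphM gk mulr_algl. Qed.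

Definition alg_morph (A B : comAlgType k) (g : {rmorphism A -> B})
    (gk : forall c : k, g c%:A = c%:A) : {lrmorphism A -> B} :=
  HB.pack (GRing.RMorphism.sort g) g
    (GRing.isScalable.Build k A B *:%R g (alg_morph_scalable gk)).

Lemma rmorphism_of (A B : comNzRingType) (g : A -> B) :
  g 1 = 1 -> {morph g : x y / x + y} -> {morph g : x y / x * y} ->
  exists g' : {rmorphism A -> B}, g' =1 g.
Proof.
move=> g1 gD gM.
have g0 : g 0 = 0 by apply: (addrI (g 0)); rewrite -gD !addr0.
have gB : zmod_morphism g.
  move=> x y; apply: (addIr (g y)).
  by rewrite -gD !subrK.
pose m1 := GRing.isZmodMorphism.Build A B g gB.
pose m2 := GRing.isMonoidMorphism.Build A B g (g1, gM).
by exists (HB.pack g m1 m2 : {rmorphism A -> B}).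
Qed.

Lemma alg_morphism_of (A B : comAlgType k) (g : A -> B) :
  (forall c : k, g c%:A = c%:A) -> {morph g : x y / x + y} ->
  {morph g : x y / x * y} -> exists g' : {lrmorphism A -> B}, g' =1 g.
Proof.
move=> gk gD gM; have g1 : g 1 = 1 by rewrite -(scale1r 1) gk scale1r.
have [g' g'E] := rmorphism_of g1 gD gM.
have g'k (c : k) : g' c%:A = c%:A by rewrite g'E gk.
by exists (alg_morph g'k).
Qed.

(** * Localizations *)

(** The value at a fraction phi x / phi a ^+ n has to be psi x * c ^+ n.  It does
    not depend on the fraction, because elements of A with the same image in B
    agree after multiplication by a power of a, which psi makes a unit. *)
Lemma localization_lift (A B C : comAlgType k) (a : A)
    (phi : {lrmorphism A -> B}) (psi : {lrmorphism A -> C}) (c : C) :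
  is_localization a phi -> psi a * c = 1 ->
  exists g : {lrmorphism B -> C}, forall x, g (phi x) = psi x.
Proof.
case=> -[b0 ab0] phi_frac phi_ker psi_c.
have {}phi_ker x : phi x = 0 -> exists n, a ^+ n * x = 0 by exact: phi_ker.
have psi_can n x : psi (a ^+ n * x) * c ^+ n = psi x.
  by rewrite rmorphM rmorphXn mulrAC -exprMn psi_c expr1n mul1r.
have gP b : exists nx : nat * A, phi a ^+ nx.1 * b = phi nx.2.
  by have [n [x e]] := phi_frac b; exists (n, x).
have [nx nxP] := choice gP.
pose g b := psi (nx b).2 * c ^+ (nx b).1.
have gE b n x : phi a ^+ n * b = phi x -> g b = psi x * c ^+ n.
  move=> bx; have [m hm] : exists m, a ^+ m * (a ^+ n * (nx b).2 - a ^+ (nx b).1 * x) = 0.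
    apply: phi_ker; rewrite rmorphB !rmorphM !rmorphXn /= -nxP -bx.
    by rewrite mulrCA subrr.
  have := congr1 psi hm; rewrite rmorph0 => /(congr1 ( *%R^~ (c ^+ m))).
  rewrite psi_can mul0r => /eqP; rewrite rmorphB subr_eq0 => /eqP e.
  rewrite /g -(psi_can n (nx b).2) e -[psi x](psi_can (nx b).1).
  by rewrite mulrAC.
have gphi x : g (phi x) = psi x.
  by rewrite (gE _ 0 x) ?expr0 ?mulr1 ?mul1r.
have [g' g'E] : exists g' : {lrmorphism B -> C}, g' =1 g.
  apply: alg_morphism_of => [e|x y|x y].
  - by rewrite -[e%:A](_ : phi e%:A = _) ?gphi ?linearZ /= rmorph1.
  - rewrite (gE (x + y) ((nx x).1 + (nx y).1)
      (a ^+ (nx y).1 * (nx x).2 + a ^+ (nx x).1 * (nx y).2)); last first.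
      rewrite rmorphD !rmorphM !rmorphXn /= -!nxP exprD mulrDr.
      by congr (_ + _); rewrite mulrA // [_ ^+ (nx y).1 * _]mulrC.
    rewrite rmorphD mulrDl exprD; congr (_ + _).
      by rewrite [c ^+ _ * _]mulrC mulrA psi_can.
    by rewrite mulrA psi_can.
  - rewrite (gE (x * y) ((nx x).1 + (nx y).1) ((nx x).2 * (nx y).2)).
      by rewrite rmorphM exprD mulrACA.
    by rewrite rmorphM /= -!nxP exprD mulrACA.
by exists g' => x; rewrite g'E gphi.
Qed.

Section Localization.
Variables (A : comAlgType k) (a : A).
Hypothesis a_nonnil : forall n, a ^+ n <> 0.

(** The kernel of A[X] -> A[1/a], X |-> 1/a; the localization is constructed as
    the quotient by it. *)
Definition inverse_ideal : {pred {poly A}} :=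
  fun p => `[< exists q, p = q * (a *: 'X - 1) >].

(** Comparing coefficients gives q_n = - a^n x, and the coefficients of q are
    eventually zero. *)
Lemma inverse_ideal_const (x : A) (q : {poly A}) :
  x%:P = q * (a *: 'X - 1) -> exists n, a ^+ n * x = 0.
Proof.
move=> xq; have qn n : q`_n = - a ^+ n * x.
  elim: n => [|n IH].
    have := congr1 (fun p : {poly A} => p`_0) xq.
    rewrite coefC mulrBr mulr1 coefB -scalerAr coefZ coefMX /= mulr0 sub0r.
    by move=> ->; rewrite expr0 mulN1r opprK.
  have := congr1 (fun p : {poly A} => p`_n.+1) xq.
  rewrite coefC mulrBr mulr1 coefB -scalerAr coefZ coefMX /= IH => /esym/eqP.
  by rewrite subr_eq0 => /eqP <-; rewrite exprS mulrA mulrN.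
exists (size q); apply/eqP; rewrite -oppr_eq0 -mulNr -qn.
by rewrite nth_default.
Qed.

Lemma inverse_ideal_closed : idealr_closed inverse_ideal.
Proof.
split.
- by apply/asboolP; exists 0; rewrite mul0r.
- apply/asboolP => -[q]; rewrite -[1]/(1%:P) => /inverse_ideal_const [n].
  by rewrite mulr1; exact: a_nonnil.
- move=> x u v /asboolP [p ->] /asboolP [q ->]; apply/asboolP.
  by exists (x * p + q); rewrite mulrDl mulrA.
Qed.

Definition inverse_idealr : idealr {poly A} :=
  HB.pack inverse_ideal (isIdealr.Build {poly A} inverse_ideal inverse_ideal_closed).

Lemma localization_exists : exists (L : comAlgType k)
  (iota : {lrmorphism A -> L}), is_localization a iota.
Proof.
pose L0 : comNzRingType := {ideal_quot inverse_idealr}.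
pose pi (p : {poly A}) : L0 := (\pi_L0 p)%qT.
have piD : {morph pi : x y / x + y} by move=> x y; exact: Quotient.pi_add.
have piM : {morph pi : x y / x * y} by move=> x y; exact: Quotient.pi_mul.
have pi1 : pi 1 = 1 by rewrite /pi piE.
have [pi' pi'E] := rmorphism_of pi1 piD piM.
pose j : {rmorphism k -> L0} := pi' \o polyC \o in_alg A.
pose g : {rmorphism A -> kalg j} := pi' \o polyC.
have gk (c : k) : g c%:A = c%:A by rewrite kalgE.
have pi_eq p q : inverse_ideal (p - q) = (pi p == pi q).
  exact: (Quotient.idealrBE inverse_idealr p q).
have pi0 p : pi p = 0 -> exists q, p = q * (a *: 'X - 1).
  move=> p0; have : inverse_ideal (p - 0) by rewrite pi_eq p0 -pi'E rmorph0.
  by rewrite subr0 => /asboolP.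
have aX : g a * pi 'X = 1.
  rewrite /= pi'E -piM -pi1; apply/eqP; rewrite -pi_eq.
  by apply/asboolP; exists 1; rewrite mul1r mul_polyC.
have frac p : exists n x, g a ^+ n * pi p = g x.
  elim/poly_ind: p => [|p c [n [x e]]].
    by exists 0%N, 0; rewrite mul1r -pi'E !rmorph0.
  exists n.+1, (x + a ^+ n.+1 * c); rewrite piD piM mulrDr rmorphD; congr (_ + _).
    by rewrite exprSr mulrACA e aX mulr1.
  by rewrite rmorphM rmorphXn /= [X in _ = _ * X]pi'E.
exists (kalg j), (alg_morph gk); split => [|b|x /=].
- by exists (pi 'X); exact: aX.
- by have := frac (repr b); rewrite /pi reprK.
- rewrite pi'E => /pi0 [q]; exact: inverse_ideal_const.
Qed.
End Localization.

(** * The affine line is a scheme *)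

Lemma unit_ideal_range (A : comNzRingType) (n : nat) (a : 'I_n -> A) :
  unit_ideal (range a) -> exists c : 'I_n -> A, \sum_i c i * a i = 1.
Proof.
case=> m [c [f [f_a <-]]].
have /choice [h hP] : forall j, exists i, a i = f j.
  by move=> j; have [i _ e] := f_a j; exists i.
exists (fun i => \sum_(j | h j == i) c j).
rewrite (partition_big h predT) //=; apply: eq_bigr => i _.
by rewrite mulr_suml; apply: eq_bigr => j /eqP <-; rewrite hP.
Qed.

(** If 1 = x + r, then 1 - x ^+ N is a multiple of r; so one generator at a time
    can be replaced by its N-th power. *)
Lemma comaximal_exp (A : comNzRingType) (n : nat) (a : 'I_n -> A) (N : nat) :
  (exists c : 'I_n -> A, \sum_i c i * a i = 1) ->
  exists c : 'I_n -> A, \sum_i c i * a i ^+ N = 1.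
Proof.
move=> a1; pose b (s : seq 'I_n) i := if i \in s then a i ^+ N else a i.
suff H (s : seq 'I_n) : uniq s -> exists c : 'I_n -> A, \sum_i c i * b s i = 1.
  have [c <-] := H _ (enum_uniq 'I_n); exists c.
  by apply: eq_bigr => i _; rewrite /b mem_enum.
elim: s => [_|i s IH /= /andP[nis us]].
  by have [c <-] := a1; exists c; apply: eq_bigr => i _; rewrite /b in_nil.
have {IH}[c] := IH us; rewrite (bigD1 i) //= => c1.
set r := \sum_(_ | _) _ in c1.
have [q qP] : exists q, 1 - (c i * b s i) ^+ N = r * q.
  have -> : c i * b s i = 1 - r by rewrite -c1 addrK.
  exists (\sum_(j < N) (1 : A) ^+ (N.-1 - j) * (1 - r) ^+ j).
  by rewrite -[X in X - _](expr1n _ N) subrXX subKr.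
exists (fun j => if j == i then c i ^+ N else c j * q).
rewrite (bigD1 i) //= eqxx /b inE eqxx /=.
have -> : 1 = (c i * b s i) ^+ N + r * q by rewrite -qP addrC subrK.
rewrite exprMn [b s i]/b (negPf nis); congr (_ + _).
rewrite /r mulr_suml; apply: eq_bigr => j /negPf ji.
by rewrite /b inE ji /= mulrAC.
Qed.

(** The sections s i are fractions x i / a i ^+ N.  They agree on the overlaps, so
    the cross differences of the fractions are killed by powers of a i * a j,
    and a partition of unity made of the powers a i ^+ (N + M) glues the
    numerators. *)
Lemma A1_sheaf : zariski_sheaf (A1 k).
Proof.
move=> A n a B phi /unit_ideal_range a_unit a_loc s s_compat.
have a_inv i : exists b, phi i (a i) * b = 1 by have [] := a_loc i.
have a_ker i x : phi i x = 0 -> exists m, a i ^+ m * x = 0.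
  by have [_ _] := a_loc i; apply.
have a_sep y : (forall i, phi i y = 0) -> y = 0.
  move=> y0; have /choice [m mP] : forall i, exists m, a i ^+ m * y = 0.
    by move=> i; apply: a_ker.
  have [c c1] := comaximal_exp (\max_i m i) a_unit.
  rewrite -[y]mul1r -c1 mulr_suml big1 // => i _.
  have /subnK <- : (m i <= \max_i m i)%N by exact: leq_bigmax.
  by rewrite exprD -!mulrA mP !mulr0.
have [N [x xP]] : exists (N : nat) (x : 'I_n -> A),
    forall i, phi i (a i) ^+ N * s i = phi i (x i).
  have /choice [mx mxP] : forall i, exists mx : nat * A,
      phi i (a i) ^+ mx.1 * s i = phi i mx.2.
    by move=> i; have [_ /(_ (s i)) [m [y e]] _] := a_loc i; exists (m, y).
  pose N := \max_i (mx i).1.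
  have leN i : ((mx i).1 <= N)%N by exact: (leq_bigmax i).
  exists N, (fun i => a i ^+ (N - (mx i).1) * (mx i).2) => i.
  by rewrite rmorphM rmorphXn /= -mxP mulrA -exprD subnK.
(* the overlap is the localization at a i * a j; it is empty, and the claim
   trivial, if this element is nilpotent *)
have [M MP] : exists M : nat, forall i j,
    (a i * a j) ^+ M * (a j ^+ N * x i - a i ^+ N * x j) = 0.
  have /choice [m mP] : forall ij : 'I_n * 'I_n, exists m,
      (a ij.1 * a ij.2) ^+ m * (a ij.2 ^+ N * x ij.1 - a ij.1 ^+ N * x ij.2) = 0.
    case=> i j /=; case: (pselect (exists m, (a i * a j) ^+ m = 0)) => [|nil].
      by case=> m e; exists m; rewrite e mul0r.
    have [C [iota iota_loc]] := localization_exists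
      (fun m e => nil (ex_intro _ m e)).
    have [[c cP] _ iota_ker] := iota_loc; apply: iota_ker.
    have iota_i : iota (a i) * (iota (a j) * c) = 1 by rewrite mulrA -rmorphM.
    have iota_j : iota (a j) * (iota (a i) * c) = 1.
      by rewrite mulrA -rmorphM [a j * _]mulrC.
    have [f fP] := localization_lift (a_loc i) iota_i.
    have [g gP] := localization_lift (a_loc j) iota_j.
    have fg : f (s i) = g (s j).
      by apply: (s_compat i j C f g) => y; rewrite fP gP.
    have fx : iota (x i) = iota (a i) ^+ N * f (s i).
      by rewrite -fP -xP rmorphM rmorphXn /= fP.
    have gx : iota (x j) = iota (a j) ^+ N * g (s j).
      by rewrite -gP -xP rmorphM rmorphXn /= gP.
    by rewrite rmorphB !rmorphM !rmorphXn /= fx gx fg mulrCA subrr.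
  pose M := \max_ij m ij.
  exists M => i j; have /subnK <- : (m (i, j) <= M)%N by exact: leq_bigmax.
  by rewrite exprD -mulrA (mP (i, j)) mulr0.
have [c c1] := comaximal_exp (N + M) a_unit.
pose s0 := \sum_j c j * (a j ^+ M * x j).
have sP i : phi i s0 = s i.
  have [b ab] := a_inv i.
  have canc (y z : B i) : phi i (a i) ^+ (N + M) * y = phi i (a i) ^+ (N + M) * z -> y = z.
    move/(congr1 ( *%R (b ^+ (N + M)))).
    by rewrite !mulrA -exprMn [b * _]mulrC ab expr1n !mul1r.
  apply: canc.
  have -> : phi i (a i) ^+ (N + M) * s i = phi i (a i ^+ M * x i).
    by rewrite exprD mulrAC xP mulrC rmorphM rmorphXn.
  rewrite -rmorphXn -rmorphM; congr (phi i _); rewrite /s0.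
  rewrite mulr_sumr -[RHS]mul1r -c1 mulr_suml; apply: eq_bigr => j _.
  have /eqP := MP i j; rewrite mulrBr subr_eq0 => /eqP e.
  rewrite mulrCA -!mulrA; congr (_ * _).
  move: e; rewrite exprMn !exprD => e.
  transitivity (a i ^+ M * a j ^+ M * (a i ^+ N * x j)); first by ring.
  by rewrite -e; ring.
exists s0; split=> // y yP.
apply/eqP; rewrite -subr_eq0; apply/eqP; apply: a_sep => i.
by rewrite rmorphB /= (yP i : phi i y = s i) sP subrr.
Qed.

Lemma A1_scheme : is_scheme (A1 k).
Proof.
split; first exact: A1_sheaf.
move=> K _ x; exists (fun _ _ => True); split=> //.
  move=> A y; exists [set 1] => B f; split=> // _.
  exists 1%N, (fun=> 1), (fun=> 1); split=> [_|].
    by exists 1; rewrite ?rmorph1.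
  by rewrite big_ord1 mulr1.
exists {poly k}, 'X; split=> // B y _.
have hk (c : k) : horner_alg (y : B) c%:A = c%:A by rewrite alg_polyC horner_algC.
pose h : {lrmorphism {poly k} -> B} := alg_morph hk.
have hX : h 'X = y by exact: horner_algX.
exists h; split=> [//|g gX p].
rewrite -[p]coefK poly_def !rmorph_sum; apply: eq_bigr => i _.
by rewrite /= !linearZ /= !rmorphXn /= (gX : g 'X = y) horner_algX mulr_algl.
Qed.
End Algebras.

(** * Polynomial rings and scalars as k-algebras *)

Section PolyAlgebra.
Variables (k : fieldType) (A : comAlgType k).

Definition polyk_unit : {rmorphism k -> {poly A}} := polyC \o in_alg A.
Definition polyk : comAlgType k := kalg polyk_unit.

Lemma polyk_evalk (t : A) (c : k) :
  (horner_eval t : {rmorphism polyk -> A}) c%:A = c%:A.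
Proof. by rewrite kalgE /= horner_evalE hornerC. Qed.

Definition polyk_eval (t : A) : {lrmorphism polyk -> A} := alg_morph (polyk_evalk t).

Lemma polykC_scalar (c : k) : (polyC : {rmorphism A -> polyk}) c%:A = c%:A.
Proof. by rewrite kalgE. Qed.

Definition polykC : {lrmorphism A -> polyk} := alg_morph polykC_scalar.

Lemma polyk_evalE t (p : {poly A}) : polyk_eval t p = p.[t].
Proof. by []. Qed.
End PolyAlgebra.

Section Scalars.
Variables (k : fieldType) (A : comAlgType k).
Lemma in_algk (c : k) : (in_alg A : {rmorphism k^o -> A}) c%:A = c%:A.
Proof. by rewrite /= [c%:A]mulr1. Qed.
Definition scalar_morph : {lrmorphism (k^o : comAlgType k) -> A} := alg_morph in_algk.
Lemma scalar_inj (c : k) : c%:A = 0 :> A -> c = 0.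
Proof. by move/eqP; rewrite scaler_eq0 oner_eq0 orbF => /eqP. Qed.
End Scalars.

(** * Infinitely many scalars *)

Lemma closed_field_infinite (k : closedFieldType) (s : seq k) :
  exists x, x \notin s.
Proof.
case: s => [|z s]; first by exists 0.
pose p := \prod_(y <- z :: s) ('X - y%:P) + 1.
have : size p != 1%N by rewrite size_polyDl size_prod_XsubC // size_poly1.
move=> /closed_rootP [x px]; exists x; apply/negP => xs.
move: px; rewrite /root /p hornerD hornerC horner_prod (big_rem x xs) /=.
by rewrite hornerXsubC subrr mul0r add0r oner_eq0.
Qed.

(** Although A may have zero divisors, roots that are scalars can be divided out
    one after the other, because differences of distinct scalars are units. *)
Lemma alg_poly_eq0 (k : closedFieldType) (A : comAlgType k) (p : {poly A})
    (s : seq k) :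
  (forall c, c \notin s -> p.[c%:A] = 0) -> p = 0.
Proof.
move: {2}(size p) (leqnn (size p)) => n; elim: n p s => [|n IH] p s.
  by rewrite leqn0 size_poly_eq0 => /eqP.
move=> pn p0; have [c cs] := closed_field_infinite s.
have /factor_theorem [q pq] : root p c%:A by apply/eqP/p0.
suff q0 : q = 0 by rewrite pq q0 mul0r.
case: (eqVneq q 0) => // qn0; apply: (IH q (c :: s)).
  by move: pn; rewrite pq size_Mmonic ?monicXsubC // size_XsubC addn2.
move=> d; rewrite inE negb_or => /andP[dc ds]; have := p0 d ds.
rewrite pq hornerM hornerXsubC -scalerBl => /(congr1 ( *%R^~ (d - c)^-1%:A)).
rewrite mul0r -mulrA -scalerAl mul1r scalerA mulfV ?scale1r ?mulr1 //.
by rewrite subr_eq0.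
Qed.

Lemma poly_eq_nonzero (k : closedFieldType) (p q : {poly k}) :
  (forall s, s != 0 -> p.[s] = q.[s]) -> p = q.
Proof.
move=> pq; apply/eqP; rewrite -subr_eq0; apply/eqP.
apply: (@alg_poly_eq0 k k^o _ [:: 0]) => s; rewrite inE [s%:A]mulr1 => s0.
by rewrite hornerD hornerN pq ?subrr.
Qed.

(** After multiplication by s^m, with m at least the degree of p, the right hand
    side is 'X^m * q and the left hand side has degree at most m. *)
Lemma inverse_poly_constant (k : closedFieldType) (p q : {poly k}) :
  (forall s, s != 0 -> p.[s^-1] = q.[s]) -> forall s, q.[s] = q.[1].
Proof.
move=> pq; pose m := size p.
have qX : 'X^m * q = \poly_(i < m.+1) p`_(m - i).
  apply: poly_eq_nonzero => s s0; rewrite hornerM hornerXn -pq // horner_poly.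
  rewrite (horner_coef_wide _ (leqnSn m)) mulr_sumr.
  rewrite [RHS](reindex_inj rev_ord_inj) /=; apply: eq_bigr => i _.
  have im : (i <= m)%N by rewrite -ltnS.
  rewrite subSS subKn // mulrCA; congr (_ * _).
  by rewrite -{1}(subnK im) exprD -mulrA -exprMn mulfV // expr1n mulr1.
have q1 : (size q <= 1)%N.
  have [->|q0] := eqVneq q 0; first by rewrite size_poly0.
  have := size_poly m.+1 (fun i => p`_(m - i)).
  by rewrite -qX size_monicM ?monicXn // size_polyXn addSn /= -addn1 leq_add2l.
by move=> s; rewrite (size1_polyC q1) !hornerC.
Qed.

Lemma exists_root (k : closedFieldType) (r : k) (N : nat) : (0 < N)%N -> exists s, s ^+ N = r.
Proof.
move=> N0; have : size ('X^N - r%:P) != 1%N by rewrite size_XnsubC // eqSS -lt0n.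
move=> /closed_rootP [s]; rewrite /root hornerD hornerN hornerC hornerXn subr_eq0.
by move=> /eqP; exists s.
Qed.

(** * Weights can be tested on scalars *)

Lemma lrmorphism_ext (k : fieldType) (A B : comAlgType k)
  (f g : {lrmorphism A -> B}) : f =1 g -> f = g.
Proof.
case: f g => [f [[[f1 f2]] [[f3 f4]] [f5]]] [g [[[g1 g2]] [[g3 g4]] [g5]]].
move=> /= /funext fg; move: fg f1 f2 f3 f4 f5 g1 g2 g3 g4 g5 => -> *.
by do !congr GRing.LRMorphism.Pack; do !f_equal; exact: Prop_irrelevance.
Qed.

Lemma Gm_ext (A : comNzRingType) (s t : Gm A) : gval s = gval t -> s = t.
Proof.
case: s t => [s s' ss'] [t t' tt'] /= st; move: st ss' => -> ts'.
have e : s' = t' by rewrite -[s']mul1r -tt' mulrAC ts' mul1r.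
by move: e ts' => -> ts'; congr MkGm; exact: Prop_irrelevance.
Qed.

Section ScalarPoints.
Variables (k : fieldType) (A : comAlgType k).

Lemma scalar_gmK (c : k) : c != 0 -> c%:A * c^-1%:A = 1 :> A.
Proof. by move=> c0; rewrite -scalerAl mul1r scalerA mulfV ?scale1r. Qed.

Definition scalar_gm (c : k) (c0 : c != 0) : Gm A := MkGm (scalar_gmK c0).
End ScalarPoints.

Lemma gm_map_scalar (k : fieldType) (A B : comAlgType k)
    (f : {lrmorphism A -> B}) (c : k) (c0 : c != 0) :
  gm_map f (scalar_gm A c0) = scalar_gm B c0.
Proof. by apply: Gm_ext; rewrite /= linearZ /= rmorph1. Qed.

Lemma gm_pow_map (A B : comNzRingType) (f : {rmorphism A -> B}) (s : Gm A) d :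
  f (gm_pow s d) = gm_pow (gm_map f s) d.
Proof. by case: d => n; rewrite /= rmorphXn. Qed.

Lemma function_nat (k : fieldType) (Y : kfunctor k) (h : global_functions Y)
    (A B : comAlgType k) (f : {lrmorphism A -> B}) (y : Y A) :
  f (h A y) = h B (kmap f y).
Proof. exact: esym (mor_nat h f y). Qed.

(** Only translations by scalars are morphisms of Y, to which a universal property
    of Y applies; this lemma passes from them to all points of G_m.  For the
    universal point X of G_m, defined over A[X, 1/X], the defect of
    homogeneity is a Laurent polynomial that vanishes at all nonzero scalars;
    so it is zero, and X can be specialized to any s. *)
Lemma has_weight_scalars (k : closedFieldType) (Y : kfunctor k)
    (rho : gm_action Y) (d : int) (h : global_functions Y) :
  (forall (c : k) (c0 : c != 0) (A : comAlgType k) (y : Y A),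
     h A (rho A (scalar_gm A c0) y) = gm_pow (scalar_gm A c0) d * h A y) ->
  has_weight rho d h.
Proof.
move=> h_scalar A s y.
have nilX n : ('X : polyk A) ^+ n <> 0.
  by move/eqP; rewrite -[_ ^+ _]/('X^n : {poly A}) -size_poly_eq0 size_polyXn.
have [L [iota iota_loc]] := localization_exists nilX.
have [[X' XX'] iota_frac iota_ker] := iota_loc.
pose X : Gm L := MkGm XX'.
pose jota : {lrmorphism A -> L} := iota \o polykC A.
(* specialization of the coordinate X at a point of G_m *)
have ev (t : Gm A) : exists e : {lrmorphism L -> A},
    (forall p : {poly A}, e (iota p) = p.[gval t]) /\ forall z, e (jota z) = z.
  have evX : polyk_eval (gval t) ('X : {poly A}) * ginv t = 1.
    by rewrite polyk_evalE hornerX gvalK.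
  have [e eP] := localization_lift iota_loc evX; exists e; split=> [p|z].
    by rewrite eP.
  by rewrite eP polyk_evalE hornerC.
have ev_y (e : {lrmorphism L -> A}) : (forall z, e (jota z) = z) -> kmap e (kmap jota y) = y.
  move=> ej; rewrite -kmap_comp -[RHS]kmap_id; congr (kmap _ y).
  by apply: lrmorphism_ext => z /=; exact: ej.
have ev_h (t : Gm A) (e : {lrmorphism L -> A}) :
    (forall p : {poly A}, e (iota p) = p.[gval t]) -> (forall z, e (jota z) = z) ->
    e (h L (rho L X (kmap jota y)) - gm_pow X d * h L (kmap jota y)) =
    h A (rho A t y) - gm_pow t d * h A y.
  move=> eX ej; have eXt : gm_map e X = t.
    by apply: Gm_ext; rewrite /= eX hornerX.
  rewrite rmorphB rmorphM gm_pow_map eXt /= !function_nat gact_nat.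
  by rewrite eXt ev_y.
set Delta := _ - _ in ev_h.
suff Delta0 : Delta = 0.
  have [e [eX ej]] := ev s; have := ev_h s e eX ej.
  by rewrite Delta0 rmorph0 => /esym/eqP; rewrite subr_eq0 => /eqP.
have [n [p pD]] := iota_frac Delta.
suff p0 : p = 0.
  move/(congr1 ( *%R (X' ^+ n))): pD; rewrite p0 rmorph0 mulr0 mulrA -exprMn.
  by rewrite mulrC [X' * _]mulrC XX' expr1n mulr1.
apply: (@alg_poly_eq0 k A p [:: 0]) => c; rewrite inE => c0.
have [e [eX ej]] := ev (scalar_gm A c0).
rewrite -[c%:A]/(gval (scalar_gm A c0)) -eX -pD rmorphM /=.
by rewrite (ev_h _ e eX ej) h_scalar subrr mulr0.
Qed.

(** * Linear inequalities *)

Lemma interpolate (F : realFieldType) (ls us : seq F) :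
  (forall l w, l \in ls -> w \in us -> l <= w) ->
  exists t, (forall l, l \in ls -> l <= t) /\ (forall w, w \in us -> t <= w).
Proof.
elim: ls => [_|l ls IH lu].
  exists (- \sum_(w <- us) `|w|); split=> // w wus.
  rewrite (big_rem w) //= lerNl (le_trans (ler_norm _)) // normrN lerDl.
  by rewrite sumr_ge0.
have [|t [lt tu]] := IH.
  by move=> l' w l'ls wus; apply: lu => //; rewrite inE l'ls orbT.
exists (Num.max l t); split=> [l'|w wus].
  by rewrite inE le_max => /orP[/eqP ->|/lt ->]; rewrite ?lexx ?orbT.
by rewrite ge_max tu // lu // inE eqxx.
Qed.

(** Elimination of one variable at a time.  The cone C stands for the inequalities
    that follow from those in cs by non-negative combinations; leaving it
    abstract allows a certificate of infeasibility to be read off in terms of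
    the multipliers of the problem at hand. *)
Lemma fourier_motzkin (F : realFieldType) (V : finType) (vs : seq V)
    (C : {ffun V -> F} -> F -> Prop) (cs : seq ({ffun V -> F} * F)) :
  uniq vs ->
  (forall (s t : F) (a : {ffun V -> F}) (b : F) (a' : {ffun V -> F}) (b' : F),
     0 <= s -> 0 <= t -> C a b -> C a' b' ->
     C [ffun w => s * a w + t * a' w] (s * b + t * b')) ->
  (forall c, c \in cs -> C c.1 c.2) ->
  (exists x : V -> F, forall c, c \in cs -> \sum_(v <- vs) c.1 v * x v <= c.2) \/
  (exists a b, [/\ C a b, forall v, v \in vs -> a v = 0 & b < 0]).
Proof.
elim: vs C cs => [|v vs IH] C cs.
  move=> _ _ csC.
  have [/allP cs0|/allPn [c ccs]] :=
    boolP (all (fun c : {ffun V -> F} * F => 0 <= c.2) cs).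
    by left; exists (fun=> 0) => c ccs; rewrite big_nil cs0.
  by rewrite -ltNge => c0; right; exists c.1, c.2; split=> //; exact: csC.
rewrite cons_uniq => /andP[vvs uvs] Cconv csC.
pose C' (a : {ffun V -> F}) (b : F) := C a b /\ a v = 0.
(* the combination of p and q in which the variable v cancels *)
pose comb (p q : {ffun V -> F} * F) : {ffun V -> F} * F :=
  ([ffun w => - q.1 v * p.1 w + p.1 v * q.1 w], - q.1 v * p.2 + p.1 v * q.2).
pose ps := [seq c : {ffun V -> F} * F <- cs | 0 < c.1 v].
pose qs := [seq c : {ffun V -> F} * F <- cs | c.1 v < 0].
pose cs' := [seq c : {ffun V -> F} * F <- cs | c.1 v == 0] ++ [seq comb p q | p <- ps, q <- qs].
have comb_in p q : p \in ps -> q \in qs -> comb p q \in cs'.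
  by move=> pps qqs; rewrite mem_cat allpairs_f ?orbT.
have C'conv s t a b a' b' : 0 <= s -> 0 <= t -> C' a b -> C' a' b' ->
     C' [ffun w => s * a w + t * a' w] (s * b + t * b').
  move=> s0 t0 [Cab av] [Cab' av']; split; first exact: Cconv.
  by rewrite !ffunE av av' !mulr0 addr0.
have [c|[x xP]|[a [b [[Cab av] avs b0]]]] := IH C' cs' uvs C'conv.
- rewrite mem_cat mem_filter => /orP[/andP[/eqP cv ccs]|]; first by split=> //; exact: csC.
  case/allpairsP => -[p q] /= [+ + ->]; rewrite !mem_filter => /andP[p0 pcs] /andP[q0 qcs].
  split; last by rewrite !ffunE /=; ring.
  by apply: Cconv; rewrite ?oppr_ge0 ?ltW //; exact: csC.
- pose rem (c : {ffun V -> F} * F) := c.2 - \sum_(w <- vs) c.1 w * x w.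
  have remP c t : c \in cs -> t * c.1 v <= rem c ->
    \sum_(w <- v :: vs) c.1 w * (if w == v then t else x w) <= c.2.
    move=> ccs; rewrite /rem lerBrDr mulrC big_cons eqxx => /(le_trans _); apply.
    rewrite lerD2l big_seq [leRHS]big_seq ler_sum // => w wvs.
    by case: eqP vvs => [<-|//]; rewrite wvs.
  have [l w|t [lt tu]] :=
      @interpolate F [seq rem q / q.1 v | q <- qs] [seq rem p / p.1 v | p <- ps].
    case/mapP => q qqs -> /mapP[p pps ->]; have := xP _ (comb_in _ _ pps qqs).
    move: pps qqs; rewrite !mem_filter => /andP[p0 pcs] /andP[q0 qcs].
    have -> : \sum_(w <- vs) (comb p q).1 w * x w =
        - q.1 v * (p.2 - rem p) + p.1 v * (q.2 - rem q).
      rewrite /rem !subKr !mulr_sumr -big_split /=.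
      by apply: eq_bigr => w' _; rewrite !ffunE /=; ring.
    rewrite ler_ndivrMr // mulrAC ler_pdivrMr //= -subr_ge0 => H.
    rewrite -subr_ge0; apply: le_trans H _; rewrite le_eqVlt; apply/orP; left.
    by apply/eqP; ring.
  left; exists (fun w => if w == v then t else x w) => c ccs; apply: remP => //.
  case: (ltgtP (c.1 v) 0) => cv.
  + rewrite -ler_ndivrMr //; apply: lt; apply: (map_f (fun q => rem q / q.1 v)).
    by rewrite mem_filter cv.
  + rewrite -ler_pdivlMr //; apply: tu; apply: (map_f (fun p => rem p / p.1 v)).
    by rewrite mem_filter cv.
  + rewrite cv mulr0 /rem subr_ge0; apply: xP.
    by rewrite mem_cat mem_filter cv eqxx ccs.
- right; exists a, b; split=> // w; rewrite inE => /orP[/eqP -> //|]; exact: avs.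
Qed.

Lemma clear_denominators (I : finType) (r : I -> rat) :
  exists (M : int) (z : I -> int), 0 < M /\ forall i, (z i)%:~R = M%:~R * r i.
Proof.
exists (\prod_i denq (r i)), (fun i => numq (r i) * \prod_(j | j != i) denq (r j)).
split=> [|i]; first by rewrite prodr_gt0.
rewrite [in RHS](bigD1 i) //= !rmorphM /= numqE; ring.
Qed.

(** * Lattice points of zonotopes *)

(** The condition on coefficients in the definition of [zonotope], homogenized:
    with varying D it describes the cone over the zonotope. *)
Definition within (F : numDomainType) (s : sign) (D c : F) : Prop :=
  match s with
  | SPos => c = D
  | SNeg => c = - D
  | SZero => - D <= c <= D
  end.

(** The maximum of m on the zonotope of a and u. *)
Definition support (n : nat) (E : finType) (u : E -> sign)
    (a : E -> 'rV[int]_n) (m : 'cV[int]_n) : int :=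
  \sum_e match u e with
         | SPos => pairing m (a e)
         | SNeg => - pairing m (a e)
         | SZero => `|pairing m (a e)|
         end.

Lemma intr_sum (F : pzRingType) (I : Type) (r : seq I) (P : pred I)
    (f : I -> int) :
  (\sum_(i <- r | P i) f i)%:~R = \sum_(i <- r | P i) (f i)%:~R :> F.
Proof. by rewrite rmorph_sum. Qed.

Lemma pairingE n (m : 'cV[int]_n) (b : 'rV[int]_n) :
  pairing m b = \sum_j b 0 j * m j 0.
Proof. by rewrite /pairing mxE. Qed.

(** Linear programming duality, over the rationals, which gives integral solutions
    after clearing denominators.  For delta = 0 it decides whether lam lies in
    the cone over the zonotope; for lam = 0 and delta = 1, whether the zonotope
    contains 0. *)
Lemma zonotope_duality (n : nat) (E : finType) (a : E -> 'rV[int]_n)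
    (u : E -> sign) (lam : 'rV[int]_n) (delta : int) : 0 <= delta ->
  (exists (c : E -> int) (D M : int),
     [/\ 0 < M, 0 <= D, delta * M <= D, forall e, within (u e) D (c e)
       & \sum_e c e *: a e = M *: lam]) \/
  (exists (m : 'cV[int]_n) (tau : int),
     [/\ 0 <= tau, support u a m + tau <= 0 & 0 < pairing m lam + tau * delta]).
Proof.
move=> delta0; pose hi e : rat := if u e is SNeg then -1 else 1.
pose lo e : rat := if u e is SPos then 1 else -1.
pose A e j : rat := (a e 0 j)%:~R.
pose L j : rat := (lam 0 j)%:~R.
(* the unknowns are the coefficients (Some e) and the dilation factor (None) *)
pose con := ({ffun option E -> rat} * rat)%type.
pose coord (s : rat) j : con :=
  ([ffun v => if v is Some e then s * A e j else 0], s * L j).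
pose up e : con :=
  ([ffun v => if v is Some e' then (e' == e)%:R else - hi e], 0).
pose dn e : con :=
  ([ffun v => if v is Some e' then - (e' == e)%:R else lo e], 0).
pose cs : seq con := [seq coord 1 j | j <- enum 'I_n] ++
  [seq coord (-1) j | j <- enum 'I_n] ++ [seq up e | e <- enum E] ++
  [seq dn e | e <- enum E] ++
  [:: ([ffun v => if v is Some _ then 0 else -1], - delta%:~R)].
(* combinations of the constraints, with multipliers p, r for the upper and lower
   bounds, tau for the bound on the dilation, and - m for the equations *)
pose C (f : {ffun option E -> rat}) (b : rat) :=
  exists (m : 'I_n -> rat) (p r : E -> rat) (tau : rat),
  [/\ (forall e, 0 <= p e) /\ (forall e, 0 <= r e), 0 <= tau,
      forall e, f (Some e) = p e - r e - \sum_j m j * A e j,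
      f None = - \sum_e (p e * hi e - r e * lo e) - tau
    & b = - \sum_j m j * L j - tau * delta%:~R].
have pick1 (I : finType) (i : I) (G : I -> rat) s :
    \sum_j s * (j == i)%:R * G j = s * G i.
  rewrite (bigD1 i) //= eqxx mulr1 big1 ?addr0 // => j /negPf ->.
  by rewrite mulr0 mul0r.
have C_coord s j : C (coord s j).1 (coord s j).2.
  exists (fun j' => - s * (j' == j)%:R), (fun=> 0), (fun=> 0), 0; split=> //.
  - by move=> e; rewrite ffunE pick1 subr0 sub0r mulNr opprK.
  - by rewrite ffunE big1 ?oppr0 ?subr0 // => e _; rewrite !mul0r subr0.
  - by rewrite pick1 mul0r subr0 mulNr opprK.
have C_up e : C (up e).1 (up e).2.
  exists (fun=> 0), (fun e' => 1 * (e' == e)%:R), (fun=> 0), 0; split=> //.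
  - by split=> e'; rewrite ?mul1r ?ler0n.
  - by move=> e'; rewrite ffunE big1 ?subr0 ?mul1r // => j _; rewrite mul0r.
  - rewrite ffunE subr0; congr (- _); rewrite -[LHS]mul1r -(pick1 _ e).
    by apply: eq_bigr => e' _; rewrite mul0r subr0.
  - by rewrite big1 ?mul0r ?subr0 ?oppr0 // => j _; rewrite mul0r.
have C_dn e : C (dn e).1 (dn e).2.
  exists (fun=> 0), (fun=> 0), (fun e' => 1 * (e' == e)%:R), 0; split=> //.
  - by split=> e'; rewrite ?mul1r ?ler0n.
  - move=> e'; rewrite ffunE big1 ?subr0 ?sub0r ?mul1r // => j _; exact: mul0r.
  - rewrite ffunE subr0 -sumrN -[LHS]mul1r -(pick1 _ e).
    by apply: eq_bigr => e' _; rewrite mul0r sub0r opprK.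
  - by rewrite big1 ?mul0r ?subr0 ?oppr0 // => j _; rewrite mul0r.
have [||[x xP]|[f [b [[m [p [r [tau [[p0 r0] tau0 fE fN bE]]]]] f0 b0]]]] :=
    @fourier_motzkin rat _ (enum {: option E}) C cs (enum_uniq _).
- move=> s t f b f' b' s0 t0 [m [p [r [tau [[p0 r0] tau0 fE fN bE]]]]].
  move=> [m' [p' [r' [tau' [[p0' r0'] tau0' fE' fN' bE']]]]].
  exists (fun j => s * m j + t * m' j), (fun e => s * p e + t * p' e),
    (fun e => s * r e + t * r' e), (s * tau + t * tau'); split=> //.
  + by split=> e; rewrite addr_ge0 ?mulr_ge0.
  + by rewrite addr_ge0 ?mulr_ge0.
  + move=> e; rewrite ffunE fE fE'.
    under [in RHS]eq_bigr do rewrite mulrDl -!mulrA.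
    by rewrite big_split /= -!mulr_sumr; ring.
  + rewrite ffunE fN fN'.
    transitivity (- (s * (\sum_e (p e * hi e - r e * lo e)) +
       t * (\sum_e (p' e * hi e - r' e * lo e))) - (s * tau + t * tau')); first by ring.
    congr (- _ - _); rewrite !mulr_sumr -big_split.
    by apply: eq_bigr => e _ /=; ring.
  + rewrite bE bE'; under [in RHS]eq_bigr do rewrite mulrDl -!mulrA.
    by rewrite big_split /= -!mulr_sumr; ring.
- move=> c; rewrite !mem_cat inE => /or4P[/mapP[j _ ->]|/mapP[j _ ->]|/mapP[e _ ->]|] //.
  case/orP=> [/mapP[e _ ->] //|/eqP -> /=].
  exists (fun=> 0), (fun=> 0), (fun=> 0), 1; split=> //.
  + by move=> e; rewrite ffunE big1 ?subr0 // => j _; rewrite mul0r.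
  + by rewrite ffunE big1 ?oppr0 ?sub0r // => j _; rewrite !mul0r subr0.
  + by rewrite big1 ?mul1r ?oppr0 ?sub0r // => j _; rewrite mul0r.
- left; have [M [z [M0 zP]]] := clear_denominators x.
  have M0' : 0 < M%:~R :> rat by rewrite ltr0z.
  have xE c : c \in cs ->
      c.1 None * x None + \sum_e c.1 (Some e) * x (Some e) <= c.2.
    move=> /xP; rewrite big_enum /= (bigD1 None) //= => /(le_trans _); apply.
    rewrite lerD2l le_eqVlt; apply/orP; left; apply/eqP.
    rewrite (reindex_omap Some id) => [|[]//].
    by apply: eq_bigl => e; rewrite eqxx.
  have in_cs : [/\ forall j, coord 1 j \in cs, forall j, coord (-1) j \in cs,
      forall e, up e \in cs & forall e, dn e \in cs].
    by split=> i; rewrite !mem_cat map_f ?mem_enum ?orbT.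
  have D_in : ([ffun v => if v is Some _ then 0 else -1], - delta%:~R) \in cs.
    by rewrite !mem_cat inE eqxx !orbT.
  have [c1_in cN_in up_in dn_in] := in_cs.
  have xup e : x (Some e) <= hi e * x None.
    have := xE _ (up_in e); rewrite ffunE /=.
    under eq_bigr do rewrite ffunE -[X in X * _]mul1r.
    by rewrite pick1 mul1r mulNr addrC subr_le0.
  have xdn e : lo e * x None <= x (Some e).
    have := xE _ (dn_in e); rewrite ffunE /=.
    under eq_bigr do rewrite ffunE mulNr -[X in - (X * _)]mul1r.
    by rewrite sumrN pick1 mul1r subr_le0.
  have xD : delta%:~R <= x None.
    have := xE _ D_in; rewrite ffunE /= big1 => [|e _]; last by rewrite ffunE mul0r.
    by rewrite addr0 mulN1r lerN2.
  have xA j : \sum_e x (Some e) * A e j = L j.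
    apply/eqP; rewrite eq_le; have := xE _ (c1_in j); have := xE _ (cN_in j).
    rewrite !ffunE !mul0r !add0r /= mul1r mulN1r.
    under eq_bigr do rewrite ffunE mulN1r mulNr mulrC.
    rewrite sumrN lerN2 => ->; under eq_bigr do rewrite ffunE mul1r mulrC.
    by move=> ->.
  exists (fun e => z (Some e)), (z None), M; split=> //.
  + by rewrite -(ler_int rat) zP mulr_ge0 ?(ltW M0') // (le_trans _ xD) ?ler0z.
  + by rewrite -(ler_int rat) zP rmorphM /= mulrC ler_pM2l.
  + move=> e; have := xup e; have := xdn e; rewrite /within /hi /lo.
    have xz i j : x i <= x j -> z i <= z j.
      by move=> ij; rewrite -(ler_int rat) !zP ler_pM2l.
    have xNz i j : x i <= - x j -> z i <= - z j.
      by move=> ij; rewrite -(ler_int rat) rmorphN /= !zP -mulrN ler_pM2l.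
    have xzN i j : - x i <= x j -> - z i <= z j.
      by move=> ij; rewrite -(ler_int rat) rmorphN /= !zP -mulrN ler_pM2l.
    case: (u e); rewrite ?mulN1r ?mul1r.
    * by move=> /xz h1 /xz h2; apply/eqP; rewrite eq_le h1 h2.
    * by move=> /xzN h1 /xNz h2; apply/eqP; rewrite eq_le h1 h2.
    * by move=> /xzN -> /xz ->.
  + apply/rowP => j; rewrite summxE mxE; apply: (@intr_inj rat).
    rewrite rmorph_sum rmorphM /= -/(L j) -xA mulr_sumr.
    by apply: eq_bigr => e _; rewrite mxE rmorphM /= zP mulrA.
- right; have [M [z [M0 zP]]] :=
    clear_denominators (fun o : option 'I_n => if o is Some j then m j else tau).
  have M0' : 0 < M%:~R :> rat by rewrite ltr0z.
  pose mz : 'cV[int]_n := \col_j z (Some j).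
  have pairE (y : 'rV[int]_n) :
      (pairing mz y)%:~R = M%:~R * (\sum_j m j * (y 0 j)%:~R) :> rat.
    rewrite pairingE intr_sum mulr_sumr; apply: eq_bigr => j _.
    by rewrite mxE rmorphM /= zP; ring.
  have q_pr e : \sum_j m j * A e j = p e - r e.
    by apply/esym/eqP; rewrite -subr_eq0 -fE f0 ?mem_enum.
  exists mz, (z None); split.
  + by rewrite -(ler_int rat) zP mulr_ge0 // ltW.
  + have tauE : tau = - \sum_e (p e * hi e - r e * lo e).
      by apply/esym/eqP; rewrite -subr_eq0 -fN f0 ?mem_enum.
    rewrite -(ler_int rat) rmorphD /= zP tauE mulrN subr_le0.
    rewrite /support intr_sum mulr_sumr ler_sum // => e _.
    have := p0 e; have := r0 e; rewrite /hi /lo.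
    case: (u e); rewrite ?intrN ?intr_norm pairE q_pr => re pe.
    * by rewrite !mulr1.
    * by rewrite -mulrN ler_pM2l //; lra.
    * rewrite normrM (gtr0_norm M0') ler_pM2l // (le_trans (ler_normB _ _)) //.
      by rewrite !ger0_norm //; lra.
  + rewrite -(ltr_int rat) rmorphD rmorphM /= pairE zP -mulrA -mulrDr.
    by rewrite mulr_gt0 // -oppr_lt0 opprD -bE.
Qed.

(** * Real points of zonotopes *)

Section RealZonotope.
Variables (R : realType) (n : nat) (E : finType) (a : E -> 'rV[int]_n).
Implicit Type u : E -> sign.

Definition real_pairing (m : 'cV[int]_n) (x : 'rV[R]_n) : R :=
  \sum_j x 0 j * (m j 0)%:~R.

Lemma real_pairing_comb (I : finType) (m : 'cV[int]_n) (c : I -> R)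
    (b : I -> 'rV[int]_n) :
  real_pairing m (\sum_i c i *: toNR R (b i)) =
  \sum_i c i * (pairing m (b i))%:~R.
Proof.
rewrite /real_pairing; under eq_bigr do rewrite summxE mulr_suml.
rewrite exchange_big; apply: eq_bigr => i _.
rewrite pairingE intr_sum mulr_sumr; apply: eq_bigr => j _.
by rewrite !mxE rmorphM /= mulrA.
Qed.

Lemma le_support u m (x : 'rV[R]_n) :
  zonotope a u x -> real_pairing m x <= (support u a m)%:~R.
Proof.
case=> c [cu ->]; rewrite real_pairing_comb intr_sum ler_sum // => e _.
have := cu e; case: (u e) => [->|->|c1]; rewrite ?mul1r ?mulN1r ?intrN //.
rewrite intr_norm (le_trans (ler_norm _)) // normrM ler_piMl //.
by rewrite ler_norml.
Qed.

Lemma zonotope_within u (c : E -> int) (D : int) (x : 'rV[R]_n) :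
  0 < D -> (forall e, within (u e) D (c e)) ->
  \sum_e (c e)%:~R *: toNR R (a e) = D%:~R *: x -> zonotope a u x.
Proof.
move=> D0 cu cx; have D0' : 0 < D%:~R :> R by rewrite ltr0z.
exists (fun e => (c e)%:~R / D%:~R); split=> [e|].
  have := cu e; case: (u e) => /= [->|->|/andP[c1 c2]].
  - by rewrite divff ?gt_eqF.
  - by rewrite rmorphN mulNr divff ?gt_eqF.
  - rewrite ler_pdivlMr // ler_pdivrMr // mul1r mulN1r -rmorphN /=.
    by rewrite !ler_int c1 c2.
transitivity (D%:~R^-1 *: (D%:~R *: x)).
  by rewrite scalerA mulVf ?scale1r ?gt_eqF.
rewrite -cx scaler_sumr; apply: eq_bigr => e _.
by rewrite scalerA mulrC.
Qed.

Lemma toNR_comb (I : finType) (c : I -> int) (b : I -> 'rV[int]_n) :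
  toNR R (\sum_i c i *: b i) = \sum_i (c i)%:~R *: toNR R (b i).
Proof.
apply/rowP => j; rewrite !(mxE, summxE) intr_sum; apply: eq_bigr => i _.
by rewrite !mxE intrM.
Qed.

(** A real representation of 0 excludes the dual alternative, so that an integral
    one exists. *)
Lemma zonotope0_relation u : zonotope a u (0 : 'rV[R]_n) ->
  exists (c : E -> int) (D : int),
    [/\ 0 < D, forall e, within (u e) D (c e) & \sum_e c e *: a e = 0].
Proof.
move=> Z0; have [[c [D [M [M0 _ MD cu c0]]]]|] :=
    zonotope_duality a u 0 (ler01 : 0 <= (1 : int)).
  exists c, D; split=> //; last by rewrite c0 scaler0.
  by rewrite (lt_le_trans M0) // -[M]mul1r.
case=> m [tau [_ sup]]; have := le_support m Z0.
rewrite [pairing m 0]pairingE /real_pairing !big1 => [s0 tau0|j _|j _].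
- move: s0; rewrite (ler_int R 0) => s0.
  by move: tau0; rewrite add0r mulr1 => tau0; lia.
- by rewrite mxE mul0r.
- by rewrite mxE mul0r.
Qed.

Lemma not_zonotope0_functional u : ~ zonotope a u (0 : 'rV[R]_n) ->
  exists m, support u a m < 0.
Proof.
move=> nZ0; have [[c [D [M [M0 _ MD cu c0]]]]|] :=
    zonotope_duality a u 0 (ler01 : 0 <= (1 : int)).
  case: nZ0; apply: (zonotope_within _ cu).
    by rewrite (lt_le_trans M0) // -[M]mul1r.
  by rewrite -toNR_comb c0 !scaler0 /toNR map_mx0.
case=> m [tau [_ sup]]; rewrite [pairing m 0]pairingE big1 => [tau0|j _].
  by exists m; rewrite add0r mulr1 in tau0; lia.
by rewrite mxE mul0r.
Qed.

(** As in [zonotope0_relation], a real solution gives an integral one. *)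
Lemma zonotope_ray_relation u (lam : 'rV[int]_n) (eps : R) :
  0 < eps -> zonotope a u (eps *: toNR R lam) ->
  exists (c : E -> int) (D M : int),
    [/\ 0 < M, 0 <= D, forall e, within (u e) D (c e)
      & \sum_e c e *: a e = M *: lam].
Proof.
move=> eps0 Zl; have [[c [D [M [M0 D0 MD cu c0]]]]|] :=
    zonotope_duality a u lam (lexx (0 : int)).
  by exists c, D, M.
case=> m [tau [tau0 sup]]; rewrite mulr0 addr0 => lam0.
have := le_support m Zl.
have -> : real_pairing m (eps *: toNR R lam) = eps * (pairing m lam)%:~R.
  have := real_pairing_comb m (fun=> eps) (fun _ : 'I_1 => lam).
  by rewrite !big_ord1.
rewrite leNgt => /negP; case; apply: (@le_lt_trans _ _ 0); last first.
  by rewrite mulr_gt0 // ltr0z.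
by rewrite (ler_int R _ 0); lia.
Qed.

Lemma interior_ray u (lam : 'rV[int]_n) :
  interior (zonotope a u : set 'rV[R]_n) 0 ->
  exists eps : R, 0 < eps /\ zonotope a u (eps *: toNR R lam).
Proof.
move=> /nbhs_ballP [e /= e0 eZ].
pose N := `|toNR R lam|.
exists (e / (N + 1)); split; first by rewrite divr_gt0 // ltr_wpDl // normr_ge0.
apply: eZ; rewrite -ball_normE /ball_ /= sub0r normrN normrZ.
have N1 : 0 < N + 1 by rewrite ltr_wpDl // normr_ge0.
rewrite ger0_norm ?divr_ge0 ?(ltW e0) ?(ltW N1) // mulrAC ltr_pdivrMr //.
by rewrite ltr_pM2l // ltrDl.
Qed.

(** Without such a functional, the cone over the zonotope contains all plus or
    minus basis vectors, by duality.  A small vector is then a convex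
    combination of 0 and of points of the zonotope on the coordinate axes. *)
Lemma interior_or_functional u : zonotope a u (0 : 'rV[R]_n) ->
  interior (zonotope a u : set 'rV[R]_n) 0 \/
  exists m, m <> 0 /\ support u a m <= 0.
Proof.
move=> Z0; case: (pselect (exists m, m <> 0 /\ support u a m <= 0)).
  by right.
move=> no_m; left.
have dirs (i : 'I_n * bool) : exists (cDM : (E -> int) * int * int),
    [/\ 0 < cDM.2, 0 <= cDM.1.2, forall e, within (u e) cDM.1.2 (cDM.1.1 e)
      & \sum_e cDM.1.1 e *: a e = cDM.2 *: ((-1) ^+ i.2 *: delta_mx 0 i.1)].
  have [[c [D [M [M0 D0 _ cu cl]]]]|] :=
      zonotope_duality a u ((-1) ^+ i.2 *: delta_mx 0 i.1) (lexx (0 : int)).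
    by exists (c, D, M).
  case=> m [tau [tau0 sup]]; rewrite mulr0 addr0 => m0; case: no_m.
  exists m; split=> [m00|]; last by lia.
  by move: m0; rewrite m00 /pairing mulmx0 mxE ltxx.
have [f fP] := choice dirs.
have [c0 [c0u c00]] := Z0.
pose S : R := \sum_i (f i).1.2%:~R.
have D0 i : 0 <= (f i).1.2%:~R :> R by have [_ D0 _ _] := fP i; rewrite ler0z.
have S0 : 0 <= S by apply: sumr_ge0.
have S1 : 0 < S + 1 by rewrite ltr_wpDl.
apply/nbhs_ballP; exists (S + 1)^-1; rewrite /= ?invr_gt0 // => x x_ball.
have x_small j : `|x 0 j| <= (S + 1)^-1.
  have := x_ball.2 0 j; rewrite mxE -ball_normE /ball_ /= sub0r normrN.
  exact: ltW.
pose i j : 'I_n * bool := (j, x 0 j < 0).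
pose w j : R := `|x 0 j| / (f (i j)).2%:~R.
have M1 j : 1 <= (f j).2%:~R :> R.
  by have [M0 _ _ _] := fP j; rewrite (ler_int R 1); lia.
have w0 j : 0 <= w j by rewrite divr_ge0 // (le_trans ler01).
have wD0 j : 0 <= w j * (f (i j)).1.2%:~R by rewrite mulr_ge0.
(* the weight of the axis points in the convex combination; 0 gets the rest *)
pose Theta := \sum_j w j * (f (i j)).1.2%:~R.
have Theta1 : Theta <= 1.
  apply: (@le_trans _ _ (\sum_j (S + 1)^-1 * (f (i j)).1.2%:~R)).
    apply: ler_sum => j _; rewrite ler_wpM2r // (le_trans _ (x_small j)) //.
    by rewrite ler_piMr // invf_le1 // (lt_le_trans ltr01).
  rewrite -mulr_sumr mulrC ler_pdivrMr // mul1r (@le_trans _ _ S) ?lerDl //.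
  rewrite /S (eq_bigr (fun j => (f (j.1, j.2)).1.2%:~R)) => [|[] //].
  rewrite -(pair_bigA _ (fun j b => (f (j, b)).1.2%:~R)) /=.
  apply: ler_sum => j _; rewrite (bigD1 (x 0 j < 0)) //= lerDl.
  exact: sumr_ge0.
pose c e := \sum_j w j * ((f (i j)).1.1 e)%:~R + (1 - Theta) * c0 e.
have Theta0 : 0 <= 1 - Theta by rewrite subr_ge0.
exists c; split=> [e|].
  have := c0u e; have fu j : within (u e) (f j).1.2 ((f j).1.1 e).
    by have [_ _ /(_ e)] := fP j.
  rewrite /c; case: (u e) fu => /= [fu ->|fu ->|fu /andP[c01 c02]].
  - by under eq_bigr do rewrite fu; rewrite -/Theta mulr1 addrC subrK.
  - under eq_bigr do rewrite fu intrN mulrN.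
    by rewrite sumrN -/Theta mulrN1 opprB addrA addNr sub0r.
  - have lo : - Theta <= \sum_j w j * ((f (i j)).1.1 e)%:~R.
      rewrite -sumrN; apply: ler_sum => j _; rewrite -mulrN ler_wpM2l //.
      by rewrite -intrN ler_int; have /andP[] := fu (i j).
    have hi : \sum_j w j * ((f (i j)).1.1 e)%:~R <= Theta.
      apply: ler_sum => j _; rewrite ler_wpM2l //.
      by rewrite ler_int; have /andP[] := fu (i j).
    have lo0 : - (1 - Theta) <= (1 - Theta) * c0 e by rewrite -mulrN1 ler_wpM2l.
    have hi0 : (1 - Theta) * c0 e <= 1 - Theta by rewrite ler_piMr.
    apply/andP; split.
      by rewrite [leLHS](_ : _ = - Theta - (1 - Theta)) ?lerD //; ring.
    by rewrite [leRHS](_ : _ = Theta + (1 - Theta)) ?lerD //; ring.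
rewrite /c; under eq_bigr do rewrite scalerDl -scalerA.
rewrite big_split /= -scaler_sumr -c00 scaler0 addr0.
under eq_bigr do rewrite scaler_suml.
rewrite exchange_big /= {1}[x]matrix_sum_delta big_ord1.
apply: eq_bigr => j _; under eq_bigr do rewrite -scalerA.
rewrite -scaler_sumr -toNR_comb; have [M0 _ _ ->] := fP (i j).
have -> : toNR R ((f (i j)).2 *: ((-1) ^+ (i j).2 *: delta_mx 0 (i j).1)) =
   (f (i j)).2%:~R *: ((-1) ^+ (x 0 j < 0)%R *: delta_mx 0 j).
  apply/rowP => j'; rewrite !mxE !intrM /=; congr (_ * (_ * _)).
    by case: (x 0 j < 0); rewrite ?expr0 ?expr1 ?intrN.
  by case: (j' == j).
rewrite !scalerA; congr (_ *: _); rewrite /w divfK ?gt_eqF ?(lt_le_trans ltr01) //.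
by rewrite mulrC -numEsign.
Qed.
End RealZonotope.

(** * Linear forms of primitive vectors *)

Section Linear.
Variables (n : nat) (E : finType) (a : E -> 'rV[int]_n).

(** The coordinates of the map dual to k^E -> N (x) k; Y is a point of the dual of
    N with values in A. *)
Definition ell (A : comNzRingType) (Y : 'I_n -> A) (e : E) : A :=
  \sum_j (a e 0 j)%:~R * Y j.

Lemma ell_morph (A B : comNzRingType) (f : {rmorphism A -> B}) Y e :
  ell (fun j => f (Y j)) e = f (ell Y e).
Proof.
by rewrite /ell rmorph_sum; apply: eq_bigr => j _; rewrite rmorphM rmorph_int.
Qed.

Lemma pairing_delta j e : pairing (delta_mx j 0) (a e) = a e 0 j.
Proof.
rewrite /pairing mxE (bigD1 j) //= mxE !eqxx mulr1 big1 ?addr0 // => i /negPf.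
by rewrite mxE => ->; rewrite mulr0.
Qed.

Lemma moment_zero_ell (k : fieldType) (A : comAlgType k) (x : S_points E A) Y :
  (forall e, x.1 e * x.2 e = ell Y e) -> moment_zero a x.
Proof.
move=> xY c cK; under eq_bigr do rewrite xY scaler_sumr.
rewrite exchange_big big1 // => j _.
transitivity ((\sum_e (a e 0 j)%:~R * c e) *: Y j).
  rewrite scaler_suml; apply: eq_bigr => e _.
  by rewrite [in LHS]mulrzl -scaler_int scalerA mulrC.
have := cK (delta_mx j 0); under eq_bigr do rewrite pairing_delta.
by move=> ->; rewrite scale0r.
Qed.

(** [LieK] is the kernel of a matrix over a field, and the vectors annihilated by
    this kernel, with entries in any algebra, form the image of the transposed
    matrix; a partial inverse of the matrix provides preimages. *)
Lemma moment_zeroP (k : fieldType) (A : comAlgType k) (x : S_points E A) :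
  moment_zero a x -> exists Y, forall e, x.1 e * x.2 e = ell Y e.
Proof.
move=> x0; pose N : 'M[k]_(#|E|, n) := \matrix_(i, j) (a (enum_val i) 0 j)%:~R.
pose P := pinvmx N.
have NPN : N *m P *m N = N by rewrite mulmxKpV.
pose b (i : 'I_#|E|) := x.1 (enum_val i) * x.2 (enum_val i).
have sumE (V : nmodType) (F : E -> V) : \sum_e F e = \sum_(i < #|E|) F (enum_val i).
  by rewrite (reindex _ (onW_bij _ (@enum_val_bij E))).
exists (fun j => \sum_i P j i *: b i) => e.
pose Q := N *m P - 1%:M; pose i := enum_rank e.
have QK : LieK a (fun e' => Q i (enum_rank e')).
  move=> m; rewrite sumE; under eq_bigr do rewrite enum_valK.
  have QN : Q *m N = 0 by rewrite mulmxBl NPN mul1mx subrr.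
  transitivity ((Q *m N *m map_mx intr m) i 0); last by rewrite QN mul0mx mxE.
  rewrite -mulmxA mxE; apply: eq_bigr => i' _; rewrite mulrC; congr (_ * _).
  rewrite /pairing !mxE rmorph_sum; apply: eq_bigr => j _.
  by rewrite !mxE rmorphM.
have := x0 _ QK; rewrite sumE; under eq_bigr do rewrite enum_valK -/(b _).
have -> : \sum_(i' < #|E|) Q i i' *: b i' =
    \sum_i' (N *m P) i i' *: b i' - b i.
  under eq_bigr do rewrite !mxE scalerBl.
  rewrite sumrB; congr (_ - _).
    by apply: eq_bigr => i' _; rewrite mxE.
  rewrite (bigD1 i) //= eqxx scale1r big1 ?addr0 // => i' /negPf.
  by rewrite eq_sym => ->; rewrite scale0r.
move/eqP; rewrite subr_eq0 {2}/b enum_rankK => /eqP <-.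
under eq_bigr do rewrite mxE scaler_suml.
rewrite exchange_big; apply: eq_bigr => j _; rewrite mulr_sumr.
apply: eq_bigr => i' _; rewrite mxE enum_rankK -scalerA scaler_int -mulrzl.
by [].
Qed.

(** If all entries vanish in k, then its characteristic p is positive and the
    vector is a multiple of p, which is not plus or minus 1. *)
Lemma primitive_mod_nonzero (k : fieldType) e : primitive (a e) ->
  exists j, (a e 0 j)%:~R != 0 :> k.
Proof.
case=> a0 a_prim; apply: contrapT => no_j.
have all0 j : (a e 0 j)%:~R = 0 :> k.
  by apply/eqP; apply: contrapT => /negP h; apply: no_j; exists j.
have [j aj] : exists j, a e 0 j != 0.
  apply: contrapT => no_j'; apply: a0; apply/rowP => j; rewrite mxE; apply/eqP.
  by apply: contrapT => /negP h; apply: no_j'; exists j.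
have absz0 (i : int) : (`|i|%N)%:R = 0 :> k -> forall p, p \in [pchar k] -> (p%:Z %| i)%Z.
  by move=> i0 p pk; rewrite dvdzE /= (dvdn_pcharf pk) i0.
have abs0 (i : 'I_n) : (absz (a e 0 i))%:R = 0 :> k.
  have := all0 i; case: (a e 0 i) => m //= /eqP.
  by rewrite NegzE rmorphN /= oppr_eq0 => /eqP.
have [|p pk] := natf0_pchar _ (introT eqP (abs0 j)); first by rewrite absz_gt0.
have p_dvd (i : 'I_n) := absz0 _ (abs0 i) p pk.
have pp := pcharf_prime pk.
have : a e = p%:Z *: \row_i divz (a e 0 i) p%:Z.
  by apply/rowP => i; rewrite !mxE mulrC divzK.
by case/a_prim => /(congr1 absz); rewrite ?abszN absz_nat => p1; rewrite p1 in pp.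
Qed.
End Linear.

(** * Polynomials on the zero fibre *)

Section Vanishing.
Variables (k : closedFieldType) (n : nat) (E : finType) (a : E -> 'rV[int]_n).
Hypothesis a_prim : forall e, primitive (a e).

(** A line through a point off the earlier hyperplanes, in a direction off the new
    one, meets each of these hyperplanes in at most one point. *)
Lemma exists_ell_neq0 : exists y : 'I_n -> k, forall e, ell a y e != 0.
Proof.
suff H (s : seq E) : exists y : 'I_n -> k, forall e, e \in s -> ell a y e != 0.
  by have [y yP] := H (enum E); exists y => e; rewrite yP ?mem_enum.
elim: s => [|e s [y0 y0P]]; first by exists (fun=> 0).
have [j aj] := primitive_mod_nonzero k (a_prim e).
pose y1 i : k := (i == j)%:R.
have y1e : ell a y1 e != 0.
  rewrite /ell (bigD1 j) //= /y1 eqxx mulr1 big1 ?addr0 // => i /negPf ->.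
  by rewrite mulr0.
have [c cP] := closed_field_infinite [seq - ell a y0 e' / ell a y1 e' | e' <- e :: s].
have ellD e' : ell a (fun i => y0 i + c * y1 i) e' = ell a y0 e' + c * ell a y1 e'.
  by rewrite /ell mulr_sumr -big_split; apply: eq_bigr => i _ /=; ring.
exists (fun i => y0 i + c * y1 i) => e' e's; rewrite ellD.
have [z|nz] := eqVneq (ell a y1 e') 0.
  rewrite z mulr0 addr0; apply: y0P; move: e's; rewrite inE => /orP[/eqP ee|//].
  by rewrite -ee z eqxx in y1e.
apply: contra cP => /eqP c0; apply/mapP; exists e' => //.
by apply: (mulIf nz); rewrite divfK // -[LHS](addKr (ell a y0 e')) c0 addr0.
Qed.

Definition exponent := {ffun E -> nat}.

Definition powp (A : comNzRingType) (x : E -> A) (b : exponent) : A :=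
  \prod_e x e ^+ b e.

Lemma powp_morph (A B : comNzRingType) (f : {rmorphism A -> B}) x b :
  powp (fun e => f (x e)) b = f (powp x b).
Proof. by rewrite rmorph_prod; apply: eq_bigr => e _; rewrite rmorphXn. Qed.

Lemma ell_poly_morph (A B : comAlgType k) (f : {lrmorphism A -> B})
    (I : Type) (r : seq I) (P : pred I) (kap : I -> k) (b : I -> exponent) Y :
  \sum_(i <- r | P i) kap i *: powp (ell a (fun j => f (Y j))) (b i) =
  f (\sum_(i <- r | P i) kap i *: powp (ell a Y) (b i)).
Proof.
rewrite rmorph_sum; apply: eq_bigr => i _ /=; rewrite linearZ /=; congr (_ *: _).
rewrite -powp_morph; apply: eq_bigr => e _; congr (_ ^+ _).
exact: (ell_morph a f).
Qed.

(** Vanishing extends from the generic y to k^n along lines through a generic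
    point, and then to A^n one coordinate at a time; at each step a polynomial
    in one variable has infinitely many scalar zeros. *)
Lemma ell_poly_vanish (I : Type) (r : seq I) (P : pred I) (kap : I -> k)
    (b : I -> exponent) :
  (forall y : 'I_n -> k, (forall e, ell a y e != 0) ->
     \sum_(i <- r | P i) kap i * powp (ell a y) (b i) = 0) ->
  forall (A : comAlgType k) (Y : 'I_n -> A),
     \sum_(i <- r | P i) kap i *: powp (ell a Y) (b i) = 0.
Proof.
move=> h0; pose h (A : comAlgType k) (Y : 'I_n -> A) : A :=
  \sum_(i <- r | P i) kap i *: powp (ell a Y) (b i).
have hk (y : 'I_n -> k) : h k^o y = 0.
  have [y0 y0P] := exists_ell_neq0.
  pose Y j : polyk k^o := (y0 j *: 'X + (y j)%:P : {poly k}).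
  have hY c : polyk_eval (c : k^o) (h _ Y) = h k^o (fun j => y j + c * y0 j).
    rewrite -ell_poly_morph; apply: eq_bigr => i _; congr (_ *: _).
    apply: eq_bigr => e _; congr (_ ^+ _); apply: eq_bigr => j _; congr (_ * _).
    by rewrite polyk_evalE /Y hornerD hornerZ hornerX hornerC addrC mulrC.
  suff Y0 : h _ Y = 0.
    by have := hY 0; rewrite Y0 rmorph0 => ->; apply: eq_bigr => i _;
      congr (_ *: powp _ _); apply: funext => e; rewrite /ell; apply: eq_bigr => j _;
      rewrite mul0r addr0.
  apply: (@alg_poly_eq0 k k^o _ [seq - ell a y e / ell a y0 e | e <- enum E]) => c.
  move=> cP; rewrite -polyk_evalE hY; apply: h0 => e.
  apply: contra cP => /eqP c0; apply/mapP; exists e; rewrite ?mem_enum //.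
  rewrite /= [c%:A]mulr1 in c0 *.
  apply: (mulIf (y0P e)); rewrite divfK // -[LHS](addKr (ell a y e)).
  rewrite -[X in _ = X]addr0 -c0; congr (_ + _).
  by rewrite /ell mulr_sumr -big_split; apply: eq_bigr => i _ /=; ring.
suff H (s : seq 'I_n) (A : comAlgType k) (Y : 'I_n -> A) :
    (forall j, j \notin s -> exists c : k, Y j = c%:A) -> h A Y = 0.
  by move=> A Y; apply: (H (enum 'I_n)) => j; rewrite mem_enum.
elim: s A Y => [|j s IH] A Y YP.
  have /choice [y yP] : forall j, exists c : k, Y j = c%:A by move=> j; apply: YP.
  have -> : Y = fun j => scalar_morph A (y j) by apply: funext.
  by rewrite /h ell_poly_morph -[X in scalar_morph A X]/(h _ _) hk rmorph0.
pose Y' i : polyk A := if i == j then 'X : {poly A} else (Y i)%:P.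
have hY' c : polyk_eval c (h _ Y') = h A (fun i => if i == j then c else Y i).
  rewrite -ell_poly_morph; apply: eq_bigr => i _; congr (_ *: powp (ell _ _) _).
  apply: funext => i'; rewrite polyk_evalE /Y'.
  by case: eqP => _; rewrite ?hornerX ?hornerC.
have -> : Y = fun i => if i == j then Y j else Y i.
  by apply: funext => i; case: eqP => [->|].
rewrite -hY'; suff -> : h _ Y' = 0 by rewrite rmorph0.
apply: (@alg_poly_eq0 k A _ [::]) => c _; rewrite -polyk_evalE hY'.
apply: IH => i ins; case: eqP => [_|/eqP ij]; first by exists c.
by apply: YP; rewrite inE negb_or ij.
Qed.

(** Independence of the characters of a torus; the exponents are separated one
    coordinate at a time. *)
Lemma monomials_separate (I : Type) (r : seq I) (kap : I -> k)
    (g : I -> exponent) :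
  (forall t : E -> k, (forall e, t e != 0) ->
     \sum_(i <- r) kap i * powp t (g i) = 0) ->
  forall g0 : exponent, \sum_(i <- r | g i == g0) kap i = 0.
Proof.
move=> sum0 g0.
suff H (s : seq E) : forall t : E -> k, (forall e, t e != 0) ->
    \sum_(i <- r | all (fun e => g i e == g0 e) s) kap i * powp t (g i) = 0.
  rewrite -[RHS](H (enum E) (fun=> 1)) => [|e]; last exact: oner_neq0.
  apply: eq_big => [i|i _]; last first.
    by rewrite /powp big1 ?mulr1 // => e _; rewrite expr1n.
  apply/eqP/allP => [-> //|gg]; apply/ffunP => e.
  by apply/eqP/gg; rewrite mem_enum.
elim: s => [|e s IH] t t0.
  by rewrite -[RHS](sum0 t t0); apply: eq_bigl.
pose p : {poly k} := \sum_(i <- r | all (fun e => g i e == g0 e) s)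
  (kap i * powp t (g i)) *: 'X^(g i e).
suff p0 : p = 0.
  rewrite -[RHS](coef0 k (g0 e)) -p0 coef_sum /= big_mkcondl.
  apply: eq_bigr => i _; rewrite coefZ coefXn eq_sym.
  by case: eqP; rewrite ?mulr1 ?mulr0.
apply: (@alg_poly_eq0 k k^o p [:: 0]) => c; rewrite inE [c%:A]mulr1 => c0.
pose t' e' := if e' == e then t e * c else t e'.
rewrite -[RHS](IH t') => [|e']; last by rewrite /t'; case: (e' =P e) => _; rewrite ?mulf_neq0 ?t0.
rewrite horner_sum; apply: eq_bigr => i _; rewrite hornerZ hornerXn -mulrA.
congr (_ * _); rewrite /powp (bigD1 e) //= [RHS](bigD1 e) //= /t' eqxx exprMn.
rewrite mulrAC; congr (_ * _); apply: eq_bigr => e' /negPf ->.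
by [].
Qed.

(** Polynomials in the z_e and w_e as lists of terms: a coefficient with the
    exponents of z and those of w.  Only their values matter. *)
Definition polynomial := seq (k * (exponent * exponent)).

Definition evalp (A : comAlgType k) (g : polynomial) (x : S_points E A) : A :=
  \sum_(m <- g) m.1 *: (powp x.1 m.2.1 * powp x.2 m.2.2).

Lemma powpM (A : comNzRingType) (x y : E -> A) b :
  powp (fun e => x e * y e) b = powp x b * powp y b.
Proof. by rewrite -big_split; apply: eq_bigr => e _; rewrite exprMn. Qed.

Lemma powpD (A : comNzRingType) (x : E -> A) (b c : exponent) :
  powp x [ffun e => (b e + c e)%N] = powp x b * powp x c.
Proof. by rewrite -big_split; apply: eq_bigr => e _; rewrite ffunE exprD. Qed.

(** Where all z_e are invertible, the zero fibre is the product of a torus and the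
    dual of N. *)
Definition torus_point (t : E -> k) (y : 'I_n -> k) : S_points E k^o :=
  (t, fun e => ell a y e / t e).

Definition generic (t : E -> k) (y : 'I_n -> k) : Prop :=
  (forall e, t e != 0) /\ (forall e, ell a y e != 0).

Lemma powp_neq0 (x : E -> k) b : (forall e, x e != 0) -> powp x b != 0.
Proof. by move=> x0; apply/prodf_neq0 => e _; rewrite expf_neq0. Qed.

(** The generic points are schematically dense in the zero fibre.  Split g into
    weight components for the torus G_m^E.  As z_e w_e = ell_e on the fibre, the
    component of weight q is the product of a monomial in which no z_e occurs
    together with w_e, and of a polynomial P in the forms ell_e.  At a generic
    point it is a character of the torus times a product of nonzero values of
    the ell_e times P, so P vanishes identically. *)
Lemma evalp_vanish (g : polynomial) :
  (forall t y, generic t y -> evalp g (torus_point t y) = 0) ->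
  forall (A : comAlgType k) (x : S_points E A), moment_zero a x -> evalp g x = 0.
Proof.
move=> g0 A x /moment_zeroP [Y xY].
pose B := (\sum_(m <- g) \sum_e m.2.2 e)%N.
have leB m e : m \in g -> (m.2.2 e <= B)%N.
  by move=> mg; rewrite /B (big_rem m) //= (bigD1 e) //= -addnA leq_addr.
(* the weight of a monomial, shifted by B to be a vector of natural numbers *)
pose wt (m : k * (exponent * exponent)) : exponent :=
  [ffun e => (m.2.1 e + (B - m.2.2 e))%N].
(* the common part of the two exponents, a monomial in the products z_e w_e *)
pose b (m : k * (exponent * exponent)) : exponent :=
  [ffun e => minn (m.2.1 e) (m.2.2 e)].
pose zw (w : exponent) : exponent := [ffun e => (w e - B)%N].
pose ww (w : exponent) : exponent := [ffun e => (B - w e)%N].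
have split_exp (p q : nat) : (q <= B)%N -> let w := (p + (B - q))%N in
    p = (minn p q + (w - B))%N /\ q = (minn p q + (B - w))%N by lia.
have alphaE m : m \in g -> m.2.1 = [ffun e => (b m e + zw (wt m) e)%N].
  move=> mg; apply/ffunP => e; rewrite /zw /wt /b !ffunE.
  by have [] := split_exp (m.2.1 e) _ (leB m e mg).
have betaE m : m \in g -> m.2.2 = [ffun e => (b m e + ww (wt m) e)%N].
  move=> mg; apply/ffunP => e; rewrite /ww /wt /b !ffunE.
  by have [] := split_exp (m.2.1 e) _ (leB m e mg).
have wt0 w : \sum_(m <- g | (m \in g) && (wt m == w)) m.1 *: powp (ell a Y) (b m) = 0.
  apply: ell_poly_vanish => y y0; have y0' := powp_neq0 (ww w) y0.
  apply: (mulIf y0'); rewrite mul0r mulr_suml.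
  transitivity (\sum_(m <- g | wt m == w) m.1 * powp (ell a y) m.2.2).
    rewrite [RHS]big_seq_cond; apply: eq_bigr => m /andP[mg /eqP <-].
    by rewrite [in RHS]betaE // powpD mulrA.
  apply: monomials_separate => t t0.
  transitivity (powp t [ffun=> B] * evalp g (torus_point t y) : k); last by rewrite g0 ?mulr0.
  rewrite mulr_sumr.
  rewrite big_seq [RHS]big_seq; apply: eq_bigr => m mg.
  rewrite [RHS]mulrCA -!mulrA; congr (_ * _); rewrite -!big_split.
  apply: eq_bigr => e _ /=; rewrite !ffunE exprD.
  have -> : t e ^+ B = t e ^+ (B - m.2.2 e) * t e ^+ m.2.2 e.
    by rewrite -exprD subnK // leB.
  rewrite exprMn exprVn; have := expf_neq0 (m.2.2 e) (t0 e).
  by move=> ?; field.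
rewrite /evalp; pose ws := undup [seq wt m | m <- g].
have wsP m : m \in g -> wt m \in ws by move=> mg; rewrite mem_undup map_f.
transitivity (\sum_(m <- g) \sum_(w <- ws | wt m == w)
    m.1 *: (powp x.1 m.2.1 * powp x.2 m.2.2)).
  rewrite big_seq [RHS]big_seq; apply: eq_bigr => m mg.
  rewrite big_mkcond (bigD1_seq (wt m)) ?undup_uniq ?wsP //= eqxx big1 ?addr0 //.
  by move=> w /negPf; rewrite eq_sym => ->.
rewrite (exchange_big_dep xpredT) //= big1 // => w _.
rewrite big_seq_cond.
transitivity ((\sum_(m <- g | (m \in g) && (wt m == w)) m.1 *: powp (ell a Y) (b m)) *
    (powp x.1 (zw w) * powp x.2 (ww w))); last by rewrite wt0 mul0r.
rewrite mulr_suml; apply: eq_bigr => m /andP[mg /eqP <-].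
rewrite -scalerAl; congr (_ *: _).
rewrite {1}(alphaE m mg) {1}(betaE m mg) !powpD mulrACA -powpM.
by congr (powp _ _ * _); apply: funext.
Qed.
End Vanishing.

Lemma XM_ext (k : fieldType) (n : nat) (E : finType) (a : E -> 'rV[int]_n)
    (u : E -> sign) (M : set (option (zero_part u) -> sign)) (A : comAlgType k)
    (x y : XM k a M A) : sval x = sval y -> x = y.
Proof. by case: x y => x xM [y yM] /= xy; exact: eq_exist. Qed.

(** * Functions on a chart *)

Section LocalFunctions.
Variables (k : closedFieldType) (E : finType) (T : pointedType).
Variables (A : comAlgType k) (x : T -> S_points E A) (v : E -> sign).

Definition polynomial_function (r : T -> A) : Prop :=
  exists g : polynomial k E, forall p, r p = evalp g (x p).

Lemma powp1 (y : E -> A) : powp y [ffun=> 0%N] = 1.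
Proof. by rewrite /powp big1 // => e _; rewrite ffunE. Qed.

Lemma polynomial_function_monomial (c : k) (b d : exponent E) :
  polynomial_function (fun p => c *: (powp (x p).1 b * powp (x p).2 d)).
Proof. by exists [:: (c, (b, d))] => p; rewrite /evalp big_seq1. Qed.

Lemma polynomial_function_const (c : k) : polynomial_function (fun=> c%:A).
Proof.
have [g gP] := polynomial_function_monomial c [ffun=> 0%N] [ffun=> 0%N].
by exists g => p; rewrite -gP !powp1 mulr1.
Qed.

Lemma polynomial_function_add r s :
  polynomial_function r -> polynomial_function s ->
  polynomial_function (fun p => r p + s p).
Proof.
by move=> [g gP] [h hP]; exists (g ++ h) => p; rewrite gP hP /evalp big_cat.
Qed.

Lemma polynomial_function_mul r s :
  polynomial_function r -> polynomial_function s ->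
  polynomial_function (fun p => r p * s p).
Proof.
move=> [g gP] [h hP].
pose ml (m l : k * (exponent E * exponent E)) : k * (exponent E * exponent E) :=
  (m.1 * l.1, ([ffun e => (m.2.1 e + l.2.1 e)%N], [ffun e => (m.2.2 e + l.2.2 e)%N])).
exists [seq ml m l | m <- g, l <- h] => p.
rewrite gP hP /evalp big_allpairs_dep mulr_suml; apply: eq_bigr => m _.
rewrite mulr_sumr; apply: eq_bigr => l _ /=.
by rewrite !powpD -scalerAl -scalerAr scalerA mulrACA.
Qed.

Definition chart_function (p : T) : A := sign_monomial v (x p).

Lemma polynomial_function_chart N : polynomial_function (fun p => chart_function p ^+ N).
Proof.
elim: N => [|N IH]; first by have := polynomial_function_const 1; rewrite scale1r.
under eq_fun do rewrite exprS.
apply: polynomial_function_mul => //.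
have [g gP] := polynomial_function_monomial 1
  [ffun e => if v e is SPos then 1 else 0]%N [ffun e => if v e is SNeg then 1 else 0]%N.
exists g => p; rewrite -gP scale1r -big_split; apply: eq_bigr => e _ /=.
by rewrite !ffunE; case: (v e); rewrite /= ?expr0 ?expr1 ?mulr1 ?mul1r.
Qed.

(** The functions g / F^N on the family x, where g is a polynomial in the
    coordinates and F the monomial that defines the chart of v. *)
Definition local_function : {pred (T -> A)} := fun r =>
  `[< exists N, polynomial_function (fun p => chart_function p ^+ N * r p) >].

Lemma polynomial_local r : polynomial_function r -> r \in local_function.
Proof.
by move=> rP; apply/asboolP; exists 0%N; under eq_fun do rewrite mul1r.
Qed.

Lemma local_function_mul r s :
  r \in local_function -> s \in local_function -> r * s \in local_function.
Proof.
move=> /asboolP [N rP] /asboolP [M sP]; apply/asboolP; exists (N + M)%N.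
have := polynomial_function_mul rP sP; congr polynomial_function.
by apply: funext => p; rewrite exprD mulrACA.
Qed.

Lemma local_function_add r s :
  r \in local_function -> s \in local_function -> r + s \in local_function.
Proof.
move=> /asboolP [N rP] /asboolP [M sP]; apply/asboolP; exists (N + M)%N.
have := polynomial_function_add
  (polynomial_function_mul (polynomial_function_chart M) rP)
  (polynomial_function_mul (polynomial_function_chart N) sP).
congr polynomial_function; apply: funext => p.
by rewrite exprD; set F := chart_function p; rewrite -[(r + s) p]/(r p + s p); ring.
Qed.

Lemma local_function_closed : subring_closed local_function.
Proof.
have const c : (fun=> c%:A) \in local_function.
  exact/polynomial_local/polynomial_function_const.
split; first by have := const 1; rewrite scale1r.
  move=> r s rl sl; apply: local_function_add => //.
  have -> : - s = (fun=> (-1)%:A) * s.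
    by apply: funext => p; rewrite -[RHS]/((-1)%:A * s p) scaleN1r mulN1r.
  exact: local_function_mul.
exact: local_function_mul.
Qed.
HB.instance Definition _ :=
  GRing.isSubringClosed.Build (T -> A) local_function local_function_closed.

Definition local_ring := {r : T -> A | local_function r}.
HB.instance Definition _ := SubChoice.on local_ring.
HB.instance Definition _ := [SubChoice_isSubComNzRing of local_ring by <:].

Lemma local_const (c : k) : local_function (fun=> c%:A).
Proof. exact/polynomial_local/polynomial_function_const. Qed.

Lemma local_unit_exists : exists j : {rmorphism k -> local_ring},
  forall c p, sval (j c) p = c%:A.
Proof.
pose j0 (c : k) : local_ring := exist local_function _ (local_const c).
have [|||j jE] := @rmorphism_of k local_ring j0.
- by apply: val_inj; apply: funext => p; rewrite /= scale1r.
- by move=> c d; apply: val_inj; apply: funext => p; rewrite /= scalerDl.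
- move=> c d; apply: val_inj; apply: funext => p.
  by rewrite -[RHS]/(c%:A * d%:A) -scalerAl mul1r scalerA.
by exists j => c p; rewrite jE.
Qed.

Definition local_unit := projT1 (cid local_unit_exists).
Definition local_algebra : comAlgType k := kalg local_unit.

Lemma local_eval_exists (p : T) : exists ev : {lrmorphism local_algebra -> A},
  forall r : local_ring, ev r = sval r p.
Proof.
have [|||ev evE] := @alg_morphism_of k local_algebra A (fun r : local_ring => sval r p).
- by move=> c; rewrite kalgE /local_unit; case: cid => j /= jE.
- by [].
- by [].
- by exists ev.
Qed.

Definition local_point (r : T -> A) (rl : local_function r) : local_algebra :=
  exist local_function r rl.

Lemma coord_local e :
  local_function (fun p => (x p).1 e) /\ local_function (fun p => (x p).2 e).
Proof.
split; apply: polynomial_local.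
  have [g gP] := polynomial_function_monomial 1 [ffun e' => (e' == e) : nat] [ffun=> 0%N].
  exists g => p; rewrite -gP scale1r powp1 mulr1 /powp (bigD1 e) //= ffunE eqxx.
  by rewrite big1 ?mulr1 // => e' /negPf; rewrite ffunE => ->.
have [g gP] := polynomial_function_monomial 1 [ffun=> 0%N] [ffun e' => (e' == e) : nat].
exists g => p; rewrite -gP scale1r powp1 mul1r /powp (bigD1 e) //= ffunE eqxx.
by rewrite big1 ?mulr1 // => e' /negPf; rewrite ffunE => ->.
Qed.

Variables (n : nat) (a : E -> 'rV[int]_n) (u : E -> sign).
Variables (M : set (option (zero_part u) -> sign)) (f : kmor (XM k a M) (A1 k)).

(** The family x is a single point of X with values in the algebra of local
    functions, so the value of f there is a local function.  In this way f is
    given on a chart by one formula, valid for any family of points. *)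
Lemma global_function_is_local (w : zero_part u -> sign) (y : T -> XM k a M A)
    (i : T -> A) :
  positive_part M w -> v = hat w -> (forall p, sval (y p) = x p) ->
  (forall p, chart_function p * i p = 1) ->
  local_function (fun p => f A (y p)).
Proof.
move=> Mw vw yx ip.
pose z e := local_point (coord_local e).1; pose w' e := local_point (coord_local e).2.
have il : local_function i.
  apply/asboolP; exists 1%N; under eq_fun do rewrite expr1 ip.
  by have := polynomial_function_const 1; rewrite scale1r.
have [ev evE] : exists ev : T -> {lrmorphism local_algebra -> A},
    forall p (r : local_ring), ev p r = sval r p.
  by have [ev evE] := choice local_eval_exists; exists ev => p r; rewrite evE.
have ext (r s : local_algebra) : (forall p, ev p r = ev p s) -> r = s.
  by move=> rs; apply: val_inj; apply: funext => p; have := rs p; rewrite !evE.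
pose X : S_points E local_algebra := (z, w').
have evX p : S_map (ev p) X = x p.
  by rewrite /S_map [RHS]surjective_pairing; congr pair; apply: funext => e; exact: evE.
have X_in : in_XM a M X.
  split.
    move=> c cK; apply: ext => p; rewrite rmorph0.
    have [m0 _] := svalP (y p); rewrite -(m0 c cK) rmorph_sum yx -evX.
    by apply: eq_bigr => e _; rewrite /= linearZ rmorphM.
  exists 1%N, (fun=> local_point il), (fun=> sign_monomial (hat w) X).
  split=> [_|]; first by exists w.
  apply: ext => p; rewrite big_ord1 rmorphM rmorph1 mulrC -(ip p); congr (_ * _).
    rewrite -vw /chart_function -evX /sign_monomial rmorph_prod.
    by apply: eq_bigr => e _ /=; case: (v e); rewrite ?rmorph1.
  by rewrite /= evE.
pose XX : XM k a M local_algebra := exist _ X X_in.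
have fX p : ev p (f _ XX) = f A (y p).
  rewrite function_nat; congr (f A _); apply: XM_ext.
  by rewrite -[LHS]/(S_map (ev p) X) evX -yx.
have -> : (fun p => f A (y p)) = sval (f _ XX : local_ring).
  by apply: funext => p; rewrite -fX evE.
by case: (f _ XX : local_ring).
Qed.
End LocalFunctions.

(** * Density of the generic points *)

Section Density.
Variables (k : closedFieldType) (n : nat) (E : finType) (a : E -> 'rV[int]_n).
Variables (u : E -> sign) (M : set (option (zero_part u) -> sign)).
Hypothesis a_prim : forall e, primitive (a e).

Lemma torus_point_moment (t : E -> k) (y : 'I_n -> k) :
  generic a t y -> moment_zero (k := k) a (torus_point a t y).
Proof.
move=> [t0 _]; apply: (@moment_zero_ell n E a k k^o _ y) => e /=.
by rewrite mulrC divfK.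
Qed.

Lemma torus_point_sign (t : E -> k) (y : 'I_n -> k) v :
  generic a t y -> sign_monomial v (torus_point a t y) != 0 :> k.
Proof.
move=> [t0 y0]; apply/prodf_neq0 => e _; case: (v e) => //=.
- exact: mulf_neq0 (y0 e) (invr_neq0 (t0 e)).
- exact: oner_neq0.
Qed.

Lemma torus_point_in (w : zero_part u -> sign) (t : E -> k) (y : 'I_n -> k) :
  positive_part M w -> generic a t y -> in_XM (k := k) a M (torus_point a t y).
Proof.
move=> Mw gty; split; first exact: torus_point_moment.
exists 1%N, (fun=> (sign_monomial (hat w) (torus_point a t y))^-1),
  (fun=> sign_monomial (hat w) (torus_point a t y)); split=> [_|]; first by exists w.
by rewrite big_ord1 mulVf // torus_point_sign.
Qed.

Definition torus_XM (w : zero_part u -> sign) (Mw : positive_part M w)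
    (t : E -> k) (y : 'I_n -> k) (g : generic a t y) : XM k a M k^o :=
  exist _ (torus_point a t y) (torus_point_in Mw g).

(** Apply [global_function_is_local] to the family that consists of all generic
    points and of x: the numerator vanishes at the generic points, hence at x
    by [evalp_vanish]. *)
Lemma vanish_on_chart (f : global_functions (XM k a M)) (w : zero_part u -> sign) :
  (forall (x : XM k a M k^o) t y, generic a t y -> sval x = torus_point a t y -> f _ x = 0) ->
  positive_part M w ->
  forall (A : comAlgType k) (x : XM k a M A) i,
    sign_monomial (hat w) (sval x) * i = 1 -> f A x = 0.
Proof.
move=> f0 Mw A x i xi.
pose U := {ty : (E -> k) * ('I_n -> k) | generic a ty.1 ty.2}.
pose U' : choiceType := HB.pack U (gen_eqMixin U) (gen_choiceMixin U).
pose T : pointedType := HB.pack (option U') (isPointed.Build (option U') None).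
pose tpt (p : U) := torus_point a (sval p).1 (sval p).2.
pose y (p : option U) : XM k a M A :=
  if p is Some q then kmap (scalar_morph A) (torus_XM Mw (svalP q)) else x.
pose I (p : option U) : A :=
  if p is Some q then scalar_morph A (sign_monomial (hat w) (tpt q))^-1 else i.
have sign_scalar (q : S_points E k^o) :
    sign_monomial (hat w) (S_map (scalar_morph A) q) =
    scalar_morph A (sign_monomial (hat w) q).
  rewrite /sign_monomial rmorph_prod.
  by apply: eq_bigr => e _; case: (hat w e); rewrite ?rmorph1.
have yI (p : T) : chart_function (fun q : T => sval (y q)) (hat w) p * I p = 1.
  case: p => [[[t z] g]|//]; rewrite /chart_function /y /= sign_scalar -rmorphM.
  by rewrite mulfV ?rmorph1 // torus_point_sign.
have := @global_function_is_local k E T A (fun p => sval (y p)) (hat w)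
  n a u M f w y I Mw erefl (fun=> erefl) yI.
move=> /asboolP [N [g gP]].
suff g0 : evalp g (sval x) = 0.
  have := gP None; rewrite g0 /chart_function /= => /(congr1 ( *%R (i ^+ N))).
  by rewrite mulr0 mulrA -exprMn [i * _]mulrC xi expr1n mul1r.
apply: (@evalp_vanish k n E a a_prim) => [t z gtz|]; last by have [] := svalP x.
have := gP (Some (exist _ (t, z) gtz)).
rewrite /y /= -function_nat (f0 _ _ _ gtz) // rmorph0 mulr0 => /esym.
have -> : evalp g (S_map (scalar_morph A) (torus_point a t z)) =
    scalar_morph A (evalp g (torus_point a t z)).
  rewrite /evalp rmorph_sum; apply: eq_bigr => m _.
  rewrite [RHS]linearZ; congr (_ *: _); rewrite [RHS]rmorphM.
  by congr (_ * _); exact: (powp_morph (scalar_morph A)).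
exact: scalar_inj.
Qed.

(** By [vanish_on_chart], f A x dies in the localization of A at each of the chart
    monomials, and these generate the unit ideal. *)
Lemma vanish_density (f : global_functions (XM k a M)) :
  (forall (x : XM k a M k^o) t y, generic a t y -> sval x = torus_point a t y -> f _ x = 0) ->
  forall (A : comAlgType k) (x : XM k a M A), f A x = 0.
Proof.
move=> f0 A x; have [_ [r [c [g [gM cg]]]]] := svalP x.
have /choice [m mP] : forall i : 'I_r, exists m, g i ^+ m * f A x = 0.
  move=> i; case: (pselect (exists m, g i ^+ m = 0)) => [|nil].
    by case=> m gm; exists m; rewrite gm mul0r.
  have [L [iota [[b ib] _ iota_ker]]] :=
    localization_exists (fun m e => nil (ex_intro _ m e)).
  apply: iota_ker; rewrite /= function_nat; have [w Mw gw] := gM i.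
  apply: (vanish_on_chart f0 Mw (i := b)); rewrite -ib -gw; congr (_ * _).
  rewrite /sign_monomial rmorph_prod.
  by apply: eq_bigr => e _ /=; case: (hat w e); rewrite ?rmorph1.
have [d d1] := comaximal_exp (\max_i m i) (ex_intro _ c cg).
rewrite -[f A x]mul1r -d1 mulr_suml big1 // => i _.
have /subnK <- : (m i <= \max_i m i)%N by exact: leq_bigmax.
by rewrite exprD -!mulrA mP !mulr0.
Qed.
End Density.

(** * Powers in the multiplicative group *)

Section GmPowers.
Variable A : comNzRingType.
Implicit Types (s t : Gm A) (d : int).

Lemma gm_powE s d (p q : nat) :
  d = p%:Z - q%:Z -> gm_pow s d = gval s ^+ p * ginv s ^+ q.
Proof.
have sK m : gval s ^+ m * ginv s ^+ m = 1 by rewrite -exprMn gvalK expr1n.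
case: d => m /= e.
  have -> : p = (m + q)%N by lia.
  by rewrite exprD -mulrA sK mulr1.
have -> : q = (p + m.+1)%N by lia.
by rewrite exprD mulrA sK mul1r.
Qed.

Lemma int_diff d : exists p q : nat, d = p%:Z - q%:Z.
Proof.
by case: d => m; [exists m, 0%N | exists 0%N, m.+1]; rewrite ?subr0 ?sub0r // NegzE.
Qed.

Lemma gm_pow0 s : gm_pow s 0 = 1. Proof. exact: expr0. Qed.

Lemma gm_powD s d d' : gm_pow s (d + d') = gm_pow s d * gm_pow s d'.
Proof.
have [p [q e]] := int_diff d; have [p' [q' e']] := int_diff d'.
rewrite (gm_powE s e) (gm_powE s e') (@gm_powE s _ (p + p') (q + q')); last lia.
by rewrite !exprD mulrACA.
Qed.

Lemma gm_powM s t d : gm_pow (gm_mul s t) d = gm_pow s d * gm_pow t d.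
Proof. by case: d => m /=; rewrite exprMn. Qed.

Lemma gm_powN s d : gm_pow s d * gm_pow s (- d) = 1.
Proof. by rewrite -gm_powD subrr gm_pow0. Qed.

Lemma gm_pow_sum (I : Type) (r : seq I) s (f : I -> int) :
  gm_pow s (\sum_(i <- r) f i) = \prod_(i <- r) gm_pow s (f i).
Proof.
by elim: r => [|i r IH]; rewrite ?big_nil ?gm_pow0 // !big_cons gm_powD IH.
Qed.

Definition gm_inv s : Gm A := MkGm (etrans (mulrC (ginv s) (gval s)) (gvalK s)).

Lemma gm_pow_inv s d : gm_pow (gm_inv s) d = gm_pow s (- d).
Proof.
have [p [q e]] := int_diff d; rewrite (gm_powE _ e) (@gm_powE s _ q p) //=; last lia.
exact: mulrC.
Qed.
End GmPowers.

Definition field_gm (k : fieldType) (s : k) (s0 : s != 0) : Gm k^o := MkGm (mulfV s0).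

Lemma field_gm_pow (k : fieldType) (s : k) (s0 : s != 0) d :
  gm_pow (field_gm s0) d = s ^ d.
Proof. by case: d => m //; exact: exprVn. Qed.

(** * Functions at the generic points *)

Section GenericValues.
Variables (k : closedFieldType) (n : nat) (E : finType) (a : E -> 'rV[int]_n).
Variables (u : E -> sign) (M : set (option (zero_part u) -> sign)).
Variable (f : global_functions (XM k a M)).
Variables (w0 : zero_part u -> sign) (Mw0 : positive_part M w0).

(** Extended by zero to all pairs, so that t and y can be changed without
    carrying proofs of genericity. *)
Definition generic_value (t : E -> k) (y : 'I_n -> k) : k :=
  if pselect (generic a t y) is left g then f k^o (torus_XM Mw0 g) else 0.
Local Notation phi := generic_value.

Lemma generic_valueE t y (x : XM k a M k^o) :
  generic a t y -> sval x = torus_point a t y -> f k^o x = phi t y.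
Proof.
move=> g xty; rewrite /phi; case: pselect => // g'.
by congr (f k^o _); apply: XM_ext; rewrite xty.
Qed.

Lemma ellZ (A : comNzRingType) (c : A) (y : 'I_n -> A) e :
  ell a (fun j => c * y j) e = c * ell a y e.
Proof. by rewrite /ell mulr_sumr; apply: eq_bigr => j _; rewrite mulrCA. Qed.

Lemma generic_scale t y (r : E -> k) (c : k) : (forall e, r e != 0) -> c != 0 ->
  generic a t y -> generic a (fun e => r e * t e) (fun j => c * y j).
Proof.
move=> r0 c0 [t0 y0]; split=> e; first exact: mulf_neq0.
by rewrite ellZ mulf_neq0.
Qed.

Lemma generic_rescale t y (r : E -> k) : (forall e, r e != 0) ->
  generic a t y -> generic a (fun e => r e * t e) y.
Proof. by move=> r0 [t0 y0]; split=> // e; exact: mulf_neq0. Qed.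

Hypothesis f_inv : Defs.invariant (@XM_Kact k n E a u M) f.

Lemma generic_value_invariant t y (c : E -> int) (s : k) :
  s != 0 -> generic a t y -> \sum_e c e *: a e = 0 ->
  phi (fun e => s ^ c e * t e) y = phi t y.
Proof.
move=> s0 g c0; have sc0 e : s ^ (- c e) != 0 by rewrite expfz_neq0.
pose tau e := field_gm (sc0 e).
have tauK m : torus_hom a tau m = 1.
  rewrite /torus_hom; transitivity (\prod_e gm_pow (field_gm s0) (- c e * pairing m (a e))).
    by apply: eq_bigr => e _; rewrite !field_gm_pow exprz_exp.
  rewrite -gm_pow_sum; have -> : \sum_e (- c e * pairing m (a e)) = 0; last exact: gm_pow0.
  transitivity (- pairing m (\sum_e c e *: a e)); last first.
    by rewrite c0 /pairing mul0mx mxE oppr0.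
  rewrite /pairing mulmx_suml summxE -sumrN; apply: eq_bigr => e _.
  by rewrite -scalemxAl [in RHS]mxE mulNr.
have := f_inv (A := k^o) (exist _ tau tauK) (torus_XM Mw0 g).
rewrite (generic_valueE (x := torus_XM Mw0 g) g) // => <-; symmetry; apply: generic_valueE.
  by apply: generic_rescale => // e; rewrite expfz_neq0.
rewrite /= /S_act /torus_point /=; congr pair; apply: funext => e.
  by rewrite mulr1 -invr_expz invrK.
have [t0 _] := g; rewrite mulr1 -invr_expz; have := expfz_neq0 (c e) s0.
by have := t0 e => t0e p0; field; rewrite t0e p0.
Qed.

Variable d : int.
Hypothesis f_weight : forall (A : comAlgType k) (s : Gm A) (x : XM k a M A),
  f A (XM_Gmact s x) = gm_pow s d * f A x.

Lemma generic_value_weight t y (s : k) : s != 0 -> generic a t y ->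
  phi (fun e => s * t e) (fun j => s ^+ 2 * y j) = s ^ d * phi t y.
Proof.
move=> s0 g; have := f_weight (field_gm s0) (torus_XM Mw0 g).
rewrite (generic_valueE (x := torus_XM Mw0 g) g) // field_gm_pow => <-; symmetry.
apply: generic_valueE.
  by apply: generic_scale; rewrite ?expf_neq0.
rewrite /= /S_act /torus_point /=; congr pair; apply: funext => e.
  by rewrite mul1r.
have [t0 _] := g; rewrite mul1r ellZ; by have := t0 e => t0e; field; rewrite t0e s0.
Qed.
End GenericValues.

(** * One-parameter degenerations *)

Section Degeneration.
Variables (k : closedFieldType) (n : nat) (E : finType) (a : E -> 'rV[int]_n).
Variables (u : E -> sign) (M : set (option (zero_part u) -> sign)).
Variable (f : global_functions (XM k a M)).

(** The orbit of a generic point under the one-parameter subgroup (s^c, s^D).  As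
    no coordinate has a negative weight and those that are invertible on the
    chart have weight zero, it is a point of X over k[s]. *)
Lemma degeneration (w : zero_part u -> sign) (c : E -> int) (D : int)
    (t : E -> k) (y : 'I_n -> k) :
  positive_part M w -> 0 <= D -> (forall e, within (hat w e) D (c e)) ->
  generic a t y ->
  exists F : {poly k}, forall s : k, exists x : XM k a M k^o,
    [/\ F.[s] = f k^o x,
        forall e, (sval x).1 e = s ^+ absz (D - c e) * t e
      & forall e, (sval x).2 e = s ^+ absz (D + c e) * (ell a y e / t e)].
Proof.
move=> Mw D0 cw g; have [t0 y0] := g.
pose X : S_points E (polyk k^o) :=
  (fun e => (t e *: 'X^(absz (D - c e)) : {poly k}),
   fun e => ((ell a y e / t e) *: 'X^(absz (D + c e)) : {poly k})).
have evX s : S_map (polyk_eval (s : k^o)) X =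
    (fun e => s ^+ absz (D - c e) * t e, fun e => s ^+ absz (D + c e) * (ell a y e / t e)).
  by congr pair; apply: funext => e; rewrite polyk_evalE hornerZ hornerXn mulrC.
have cD e : (absz (D - c e)%R + absz (D + c e)%R = 2 * absz D)%N.
  by have := cw e; case: (hat w e) => /=; lia.
have X_in : in_XM a M X.
  split.
    apply: (@moment_zero_ell n E a k (polyk k^o) X
      (fun j => (y j *: 'X^(2 * absz D) : {poly k}))) => e.
    rewrite /ell /=.
    have -> : (\sum_j (a e 0 j)%:~R * (y j *: 'X^(2 * absz D)) : {poly k}) =
        ell a y e *: 'X^(2 * absz D).
      rewrite /ell scaler_suml; apply: eq_bigr => j _.
      by rewrite [LHS]mulrzl -scaler_int scalerA.
    rewrite -[LHS]/((_ *: _) * (_ *: _) : {poly k}).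
    by rewrite -scalerAl -scalerAr scalerA -exprD cD mulrC divfK.
  have signX : sign_monomial (hat w) X =
      (sign_monomial (hat w) (torus_point a t y))%:P :> {poly k}.
    rewrite /sign_monomial (rmorph_prod polyC); apply: eq_bigr => e _ /=.
    have := cw e; case: (hat w e) => //= ->.
      by rewrite subrr expr0 alg_polyC.
    by rewrite subrr expr0 alg_polyC.
  exists 1%N, (fun=> ((sign_monomial (hat w) (torus_point a t y))^-1%:P : {poly k})),
    (fun=> sign_monomial (hat w) X); split=> [_|]; first by exists w.
  rewrite big_ord1 signX -[LHS]/(_%:P * _%:P : {poly k}) -polyCM.
  by rewrite mulVf // torus_point_sign.
pose XX : XM k a M (polyk k^o) := exist _ X X_in.
exists (f _ XX) => s; exists (kmap (polyk_eval (s : k^o)) XX).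
split=> [|e|e]; first by rewrite -function_nat.
  by rewrite -[sval _]/(S_map (polyk_eval (s : k^o)) X) evX.
by rewrite -[sval _]/(S_map (polyk_eval (s : k^o)) X) evX.
Qed.

(** * Vanishing in negative weight and constancy in weight zero *)

Hypothesis a_prim : forall e, primitive (a e).
Hypothesis f_inv : Defs.invariant (@XM_Kact k n E a u M) f.
Variable d : int.
Hypothesis f_weight : forall (A : comAlgType k) (s : Gm A) (x : XM k a M A),
  f A (XM_Gmact s x) = gm_pow s d * f A x.

(** For s different from 0 the orbit consists of translates of the generic point,
    by s^D in G_m and by s^c in the torus G_m^E. *)
Lemma generic_orbit (w : zero_part u -> sign) (Mw : positive_part M w)
    (c : E -> int) (D : int) (s : k) t y (x : XM k a M k^o) :
  s != 0 -> 0 <= D -> (forall e, within (hat w e) D (c e)) -> generic a t y ->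
  (forall e, (sval x).1 e = s ^+ absz (D - c e) * t e) ->
  (forall e, (sval x).2 e = s ^+ absz (D + c e) * (ell a y e / t e)) ->
  f k^o x = (s ^ D) ^ d * generic_value f Mw (fun e => s ^ (- c e) * t e) y.
Proof.
move=> s0 D0 cw g x1 x2; have [t0 y0] := g.
have g' : generic a (fun e => s ^ (- c e) * t e) y.
  by apply: generic_rescale => // e; rewrite expfz_neq0.
rewrite -(generic_value_weight Mw f_weight) ?expfz_neq0 //.
apply: generic_valueE.
  by apply: generic_scale; rewrite ?expf_neq0 ?expfz_neq0.
have Dc e : 0 <= D - c e /\ 0 <= D + c e.
  by have := cw e; case: (hat w e) => /=; lia.
have pD := expfz_neq0 D s0; have sD m : 0 <= m -> s ^+ absz m = s ^ m.
  by move=> /gez0_abs m0; rewrite -[LHS]/(s ^ (absz m)%:Z) m0.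
rewrite [LHS]surjective_pairing; congr pair; apply: funext => e.
  have [De _] := Dc e; rewrite x1 sD // expfzDr //.
  by rewrite -mulrA.
have [_ De] := Dc e; have pc := expfz_neq0 (c e) s0; have te := t0 e.
rewrite x2 ellZ sD // expfzDr // -invr_expz.
by field; rewrite te pc pD.
Qed.

Lemma generic_value_indep (w w' : zero_part u -> sign) (Mw : positive_part M w)
    (Mw' : positive_part M w') t y :
  generic a t y -> generic_value f Mw t y = generic_value f Mw' t y.
Proof.
move=> g; transitivity (f k^o (torus_XM Mw g)); last exact: generic_valueE.
by symmetry; apply: generic_valueE.
Qed.

(** As c is a relation, s^c lies in K; along the degeneration f is the polynomial
    F with F(s) = s^(D d) times the value at the generic point.  Since D d < 0,
    this value is s^(- D d) F(s) at s = 0, which is zero. *)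
Lemma negative_weight_vanish (w : zero_part u -> sign) (c : E -> int) (D : int) :
  positive_part M w -> 0 < D -> (forall e, within (hat w e) D (c e)) ->
  \sum_e c e *: a e = 0 -> d < 0 ->
  forall (A : comAlgType k) (x : XM k a M A), f A x = 0.
Proof.
move=> Mw D0 cw c0 d0; apply: vanish_density => // x t y g xty.
rewrite (generic_valueE f Mw g xty).
have [F FP] := degeneration Mw (ltW D0) cw g.
pose N := absz (D * d).
have FX : F * 'X^N = (generic_value f Mw t y)%:P.
  apply: poly_eq_nonzero => s s0; rewrite hornerM hornerC hornerXn.
  have [z [-> z1 z2]] := FP s; rewrite (generic_orbit Mw s0 (ltW D0) cw g z1 z2).
  rewrite generic_value_invariant //; last first.
    by under eq_bigr do rewrite scaleNr; rewrite sumrN c0 oppr0.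
  have -> : s ^+ N = ((s ^ D) ^ d)^-1.
    rewrite exprz_exp invr_expz -[LHS]/(s ^ N%:Z); congr (s ^ _).
    by rewrite /N; nia.
  by rewrite mulrAC mulfV ?mul1r // !expfz_neq0.
have := congr1 (fun p : {poly k} => p.[0]) FX.
have N0 : (0 < N)%N by rewrite absz_gt0 mulf_neq0 ?(gt_eqF D0) ?(lt_eqF d0).
by rewrite hornerM hornerXn hornerC expr0n gtn_eqF // mulr0 => <-.
Qed.

Definition at_coord (e0 : E) (r : k) (e : E) : k := if e == e0 then r else 1.

(** Modulo K, the two degenerations move only the coordinate e0 of the torus, in
    opposite directions.  As a function of this coordinate f is a polynomial in
    both directions, hence constant on N N'-th powers; and every r is such a
    power. *)
Lemma generic_value_coord (w0 : zero_part u -> sign) (Mw0 : positive_part M w0)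
    (e0 : E) :
  d = 0 ->
  (forall b : bool, exists (w : zero_part u -> sign) (c : E -> int) (D N : int),
    [/\ positive_part M w, 0 < N, 0 <= D, forall e, within (hat w e) D (c e)
      & \sum_e c e *: a e = N *: ((-1) ^+ b *: a e0)]) ->
  forall t y r, generic a t y -> r != 0 ->
    generic_value f Mw0 (fun e => at_coord e0 r e * t e) y = generic_value f Mw0 t y.
Proof.
move=> d0 rays t y r g r0.
pose H r := generic_value f Mw0 (fun e => at_coord e0 r e * t e) y.
have ray (b : bool) : exists (N : nat) (F : {poly k}), (0 < N)%N /\
    forall s, s != 0 -> F.[s] = H (s ^ (- ((-1) ^+ b * N%:Z))).
  have [w [c [D [N [Mw N0 D0 cw cN]]]]] := rays b.
  have [F FP] := degeneration Mw D0 cw g.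
  exists (absz N), F; split=> [|s s0]; first by rewrite absz_gt0 gt_eqF.
  have [z [-> z1 z2]] := FP s.
  rewrite (generic_orbit Mw s0 D0 cw g z1 z2) d0 expr0z mul1r gtz0_abs //.
  have g' : generic a (fun e => s ^ (- c e) * t e) y.
    by apply: generic_rescale => // e; rewrite expfz_neq0.
  rewrite (generic_value_indep Mw Mw0 g').
  (* the relation by which s^c differs from a subgroup of the coordinate e0 *)
  pose c' e := c e - (e == e0)%:Z * ((-1) ^+ b * N).
  rewrite -(generic_value_invariant Mw0 f_inv (c := c') s0 g').
    congr (generic_value f Mw0 _ y); apply: funext => e.
    rewrite mulrA -expfzDr //; congr (_ * _); rewrite /c' /at_coord.
    rewrite addrAC subrr add0r; case: (e == e0); first by rewrite mul1r.
    by rewrite mul0r oppr0 expr0z.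
  under eq_bigr do rewrite scalerBl; rewrite sumrB cN (bigD1 e0) //= eqxx mul1r.
  rewrite big1 => [|e /negPf ->]; last by rewrite mul0r scale0r.
  by rewrite addr0 scalerA mulrC subrr.
have [N [F [N0 FP]]] := ray false; have [N' [F' [N0' FP']]] := ray true.
have const s : s != 0 -> H (s ^+ (N * N')) = H 1.
  pose p := F \Po 'X^N'; pose q := F' \Po 'X^N.
  have qE z : z != 0 -> q.[z] = H (z ^+ (N * N')).
    move=> z0; rewrite /q horner_comp hornerXn FP' ?expf_neq0 //.
    by rewrite expr1 mulN1r opprK -[z ^+ N]/(z ^ N%:Z) exprz_exp.
  have pq z : z != 0 -> p.[z^-1] = q.[z].
    move=> z0; rewrite qE // /p horner_comp hornerXn FP ?expf_neq0 ?invr_neq0 //.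
    by rewrite expr0 mul1r -invr_expz -[_ ^ N%:Z]/(_ ^+ N) !exprVn invrK -exprM mulnC.
  move=> s0; rewrite -qE // (inverse_poly_constant pq) qE ?oner_neq0 //.
  by rewrite expr1n.
have [|s sr] := @exists_root k r (N * N'); first by rewrite muln_gt0 N0.
have s0 : s != 0.
  by apply: contra_neq r0 => s0; rewrite -sr s0 expr0n muln_eq0 !gtn_eqF.
rewrite -/(H r) -sr const // /H; congr (generic_value f Mw0 _ y).
by apply: funext => e; rewrite /at_coord; case: eqP; rewrite mul1r.
Qed.

(** By [generic_value_coord], f is invariant under G_m^E.  The degeneration with
    c the sign vector of a tile has a limit that keeps only the coordinates
    invertible on its chart.  These can be prescribed by the torus, so that any
    two generic points have a common limit after a translation. *)
Lemma weight_zero_constant (w0 : zero_part u -> sign) (Mw0 : positive_part M w0) :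
  d = 0 ->
  (forall (e0 : E) (b : bool), exists (w : zero_part u -> sign) (c : E -> int) (D N : int),
    [/\ positive_part M w, 0 < N, 0 <= D, forall e, within (hat w e) D (c e)
      & \sum_e c e *: a e = N *: ((-1) ^+ b *: a e0)]) ->
  exists c : k, forall (A : comAlgType k) (x : XM k a M A), f A x = c%:A.
Proof.
move=> d0 rays; pose phi := generic_value f Mw0.
have torus t t' y : generic a t y -> generic a t' y -> phi t' y = phi t y.
  move=> g g'; suff H (s : seq E) : forall t', generic a t' y ->
      (forall e, e \notin s -> t' e = t e) -> phi t' y = phi t y.
    by apply: (H (enum E)) => // e; rewrite mem_enum.
  elim: s => [t1 _ t1t|e s IH t1 g1 t1t].
    by congr (phi _ y); apply: funext => e; rewrite t1t.
  have [t0 _] := g; have [t10 _] := g1.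
  have r0 : t e / t1 e != 0 by rewrite mulf_neq0 ?invr_neq0.
  rewrite /phi -(generic_value_coord Mw0 d0 (rays e) g1 r0); apply: IH => [|e' es].
    by apply: generic_rescale g1 => e'; rewrite /at_coord; case: (e' == e) => //; exact: oner_neq0.
  rewrite /at_coord; case: (eqVneq e' e) => [->|ne]; first by rewrite divfK.
  by rewrite mul1r t1t // inE negb_or ne.
pose c e : int := match hat w0 e with SPos => 1 | SNeg => -1 | SZero => 0 end.
have cw e : within (hat w0 e) 1 (c e) by rewrite /c; case: (hat w0 e).
have limit t y : generic a t y -> exists x : XM k a M k^o,
    [/\ phi t y = f k^o x,
        forall e, (sval x).1 e = if hat w0 e is SPos then t e else 0
      & forall e, (sval x).2 e = if hat w0 e is SNeg then ell a y e / t e else 0].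
  move=> g; have [F FP] := degeneration Mw0 ler01 cw g.
  have FC : F = (phi t y)%:P.
    apply: poly_eq_nonzero => s s0; rewrite hornerC; have [x [-> x1 x2]] := FP s.
    rewrite (generic_orbit Mw0 s0 ler01 cw g x1 x2) d0 expr0z mul1r.
    apply: torus => //; apply: generic_rescale => // e.
    by rewrite expfz_neq0.
  have [x [Fx x1 x2]] := FP 0; exists x; split=> [|e|e].
  - by rewrite -Fx FC hornerC.
  - by rewrite x1 /c; case: (hat w0 e); rewrite /= ?expr0 ?mul1r ?expr0n ?mul0r.
  - by rewrite x2 /c; case: (hat w0 e); rewrite /= ?expr0 ?mul1r ?expr0n ?mul0r.
have phi_const t y t' y' : generic a t y -> generic a t' y' -> phi t y = phi t' y'.
  move=> g g'; have [[t0 y0] [t0' y0']] := (g, g').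
  pose t1 e := if hat w0 e is SNeg then ell a y' e / ell a y e * t e else t e.
  have g1 : generic a t1 y'.
    split=> // e; rewrite /t1; case: (hat w0 e) => //.
    by rewrite !mulf_neq0 ?invr_neq0.
  rewrite (torus t1 t' y' g1 g').
  have [x [-> x1 x2]] := limit t y g; have [x' [-> x1' x2']] := limit t1 y' g1.
  congr (f k^o _); apply: XM_ext; rewrite [LHS]surjective_pairing [RHS]surjective_pairing.
  congr pair; apply: funext => e; first by rewrite x1 x1' /t1; case: (hat w0 e).
  rewrite x2 x2' /t1; case: (hat w0 e) => //.
  have te := t0 e; have ye := y0 e; have ye' := y0' e.
  by field; rewrite te ye ye'.
have [y0 y0P] := exists_ell_neq0 k a_prim.
have g0 : generic a (fun=> 1) y0 by split=> // e; exact: oner_neq0.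
exists (phi (fun=> 1) y0) => A x; apply/eqP; rewrite -subr_eq0; apply/eqP.
pose f1 (A : comAlgType k) (x : XM k a M A) : A1 k A := f A x - (phi (fun=> 1) y0)%:A.
have f1_nat (A' B : comAlgType k) (g : {lrmorphism A' -> B}) (z : XM k a M A') :
    f1 B (kmap g z) = kmap g (f1 A' z).
  have gk (r : k) : g r%:A = r%:A by rewrite linearZ /= rmorph1.
  by rewrite /= /A1_fmap /f1 rmorphB /= gk function_nat.
pose f' : global_functions (XM k a M) := KMor f1_nat.
apply: (@vanish_density k n E a u M a_prim f') => z t y g zE.
rewrite /= /f1 (generic_valueE f Mw0 g zE) -/(phi t y) (phi_const _ _ _ _ g g0).
by rewrite [_%:A]mulr1 subrr.
Qed.
End Degeneration.

(** * Monomial functions *)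

(** The inverse is not an operation of A; its choice is immaterial, since inverses
    are unique. *)
Definition unit_pow (A : comNzRingType) (z : A) (d : int) : A :=
  if pselect (exists s : Gm A, gval s = z) is left e then gm_pow (projT1 (cid e)) d
  else 0.

Lemma unit_powE (A : comNzRingType) (s : Gm A) d : unit_pow (gval s) d = gm_pow s d.
Proof.
rewrite /unit_pow; case: pselect => [e|[]]; last by exists s.
by case: cid => s' /= /Gm_ext ->.
Qed.

Lemma gm_pow1 (A : comNzRingType) d : gm_pow (gm1 A) d = 1.
Proof. by case: d => p /=; rewrite expr1n. Qed.

Section Monomial.
Variables (k : closedFieldType) (n : nat) (E : finType) (a : E -> 'rV[int]_n).
Variables (u : E -> sign) (M : set (option (zero_part u) -> sign)).
Variable m : 'cV[int]_n.
Local Notation q e := (pairing m (a e)).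

Lemma hat_nonzero (w : zero_part u -> sign) e : u e <> SZero -> hat w e = u e.
Proof.
move=> ue; rewrite /hat; case: insubP => // e' ue' _.
by case: (u e) ue ue'.
Qed.

(** Each chart monomial contains z_e or w_e as a factor, according to the sign
    u_e when it is nonzero, and together they generate the unit ideal. *)
Lemma XM_units (A : comAlgType k) (x : XM k a M A) e :
  match u e with
  | SPos => exists s : Gm A, gval s = (sval x).1 e
  | SNeg => exists s : Gm A, gval s = (sval x).2 e
  | SZero => True
  end.
Proof.
have [_ [r [c [g [gM cg]]]]] := svalP x.
have divides (z : A) : (forall w : zero_part u -> sign, exists b,
      sign_monomial (hat w) (sval x) = z * b) ->
    exists s : Gm A, gval s = z.
  move=> zP; have /choice [b bP] : forall i, exists b, g i = z * b.
    by move=> i; have [w _ <-] := gM i; exact: zP.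
  suff zb : z * (\sum_i c i * b i) = 1 by exists (MkGm zb).
  by rewrite -cg mulr_sumr; apply: eq_bigr => i _; rewrite bP mulrCA.
case ue: (u e) => //; apply: divides => w; rewrite /sign_monomial (bigD1 e) //=.
  by rewrite hat_nonzero ue //; eexists.
by rewrite hat_nonzero ue //; eexists.
Qed.

(** The torus acts on this factor through the power - m(a_e) of its e-th
    coordinate.  It is made of z_e or w_e, whichever is invertible, or occurs
    with a non-negative exponent. *)
Definition monomial_factor (A : comNzRingType) (x : S_points E A) (e : E) : A :=
  match u e with
  | SPos => unit_pow (x.1 e) (q e)
  | SNeg => unit_pow (x.2 e) (- q e)
  | SZero => if 0 <= q e then x.1 e ^+ absz (q e) else x.2 e ^+ absz (q e)
  end.

Definition degree e : int :=
  match u e with SPos => q e | SNeg => - q e | SZero => `|q e| end.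

Lemma monomial_factor_map (A B : comAlgType k) (f : {lrmorphism A -> B})
    (x : XM k a M A) e :
  monomial_factor (S_map f (sval x)) e = f (monomial_factor (sval x) e).
Proof.
have := XM_units x e; rewrite /monomial_factor.
case: (u e) => [[s sx]|[s sx]|_] /=.
- by rewrite -sx unit_powE (gm_pow_map f) -unit_powE.
- by rewrite -sx unit_powE (gm_pow_map f) -unit_powE.
- by case: ifP => _; rewrite rmorphXn.
Qed.

Lemma monomial_factor_act (A : comAlgType k) (t : E -> Gm A) (s : Gm A)
    (x : XM k a M A) e :
  monomial_factor (S_act t s (sval x)) e * gm_pow (t e) (q e) =
  gm_pow s (degree e) * monomial_factor (sval x) e.
Proof.
have := XM_units x e; rewrite /monomial_factor /degree.
case: (u e) => [[r rx]|[r rx]|_] /=.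
- rewrite -rx unit_powE.
  rewrite -[X in unit_pow X]/(gval (gm_mul (gm_mul (gm_inv (t e)) s) r)) unit_powE.
  rewrite !gm_powM gm_pow_inv mulrC !mulrA gm_powN mul1r.
  by [].
- rewrite -rx unit_powE.
  rewrite -[X in unit_pow X]/(gval (gm_mul (gm_mul (t e) s) r)) unit_powE.
  by rewrite !gm_powM mulrC !mulrA gm_powN mul1r.
- case: ifP => q0.
    rewrite (_ : gm_pow (t e) (q e) = gval (t e) ^+ absz (q e)); last first.
      by case: (q e) q0.
    rewrite -!exprMn; congr (_ ^+ _).
    transitivity (gval (t e) * ginv (t e) * (gval s * (sval x).1 e)); first by ring.
    by rewrite gvalK mul1r.
  rewrite (_ : gm_pow (t e) (q e) = ginv (t e) ^+ absz (q e)); last first.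
    by case: (q e) q0 => // p _ /=.
  rewrite -!exprMn; congr (_ ^+ _).
  transitivity (gval (t e) * ginv (t e) * (gval s * (sval x).2 e)); first by ring.
  by rewrite gvalK mul1r.
Qed.

Definition monomial_value (A : comAlgType k) (x : XM k a M A) : A1 k A :=
  \prod_e monomial_factor (sval x) e : A.

Lemma monomial_nat (A B : comAlgType k) (f : {lrmorphism A -> B}) (x : XM k a M A) :
  monomial_value (kmap f x) = kmap f (monomial_value x).
Proof.
rewrite /= /A1_fmap /monomial_value rmorph_prod; apply: eq_bigr => e _.
exact: monomial_factor_map.
Qed.

Definition monomial_function : global_functions (XM k a M) := KMor monomial_nat.

Lemma monomial_function_act (A : comAlgType k) (t : E -> Gm A) (s : Gm A)
    (x : XM k a M A) :
  (monomial_function A (XM_act t s x) : A) * torus_hom a t m =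
  gm_pow s (support u a m) * monomial_function A x.
Proof.
rewrite /= /monomial_value /torus_hom -big_split gm_pow_sum -big_split.
by apply: eq_bigr => e _; exact: monomial_factor_act.
Qed.

Lemma monomial_invariant : Defs.invariant (@XM_Kact k n E a u M) monomial_function.
Proof.
move=> A [t tK] x; have := monomial_function_act t (gm1 A) x.
by rewrite [torus_hom _ _ _]tK mulr1 gm_pow1 mul1r.
Qed.

Lemma monomial_weight (A : comAlgType k) (s : Gm A) (x : XM k a M A) :
  monomial_function A (XM_Gmact s x) = gm_pow s (support u a m) * monomial_function A x.
Proof.
rewrite -(monomial_function_act (fun=> gm1 A)) /torus_hom big1 ?mulr1 // => e _.
exact: gm_pow1.
Qed.

Lemma unit_pow_neq0 (K : fieldType) (z : K) d : z != 0 -> unit_pow z d != 0.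
Proof.
move=> z0; rewrite -[z]/(gval (MkGm (mulfV z0))) unit_powE.
apply/eqP => zd; have := gm_powN (MkGm (mulfV z0)) d.
by rewrite zd mul0r => /esym/eqP; rewrite oner_eq0.
Qed.

Lemma monomial_generic_neq0 (x : XM k a M k^o) t y :
  generic a t y -> sval x = torus_point a t y -> monomial_function k^o x != 0 :> k.
Proof.
move=> [t0 y0] xE; rewrite /= /monomial_value xE; apply/prodf_neq0 => e _.
have l0 : ell a y e / t e != 0 by rewrite mulf_neq0 ?invr_neq0.
rewrite /monomial_factor; case: (u e) => /=.
- exact: unit_pow_neq0.
- exact: unit_pow_neq0.
- by case: ifP => _; rewrite expf_neq0.
Qed.
End Monomial.

(** * Functions on the quotient *)

Section Descent.
Variables (k : closedFieldType) (X Y : kfunctor k) (G : comAlgType k -> Type).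
Variables (act : forall A : comAlgType k, G A -> X A -> X A) (pi : kmor X Y).
Hypothesis pi_quot : categorical_quotient act pi.
Variables (gX : forall A : comAlgType k, Gm A -> X A -> X A) (rho : gm_action Y).
Hypothesis pi_equiv : forall (A : comAlgType k) (s : Gm A) (x : X A),
  pi A (gX s x) = rho A s (pi A x).

Lemma pullback_proof (h : global_functions Y) (A B : comAlgType k)
    (f : {lrmorphism A -> B}) (x : X A) :
  h B (pi B (kmap f x)) = kmap f (h A (pi A x)).
Proof. by rewrite !mor_nat. Qed.

Definition pullback (h : global_functions Y) : global_functions X :=
  KMor (pullback_proof h).

Lemma pullback_inj (h h' : global_functions Y) :
  (forall A x, h A (pi A x) = h' A (pi A x)) -> forall A y, h A y = h' A y.
Proof.
case: pi_quot => _ pi_inv /(_ _ (pullback h') (A1_scheme k)) [].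
  by move=> A t x /=; rewrite pi_inv.
move=> h0 [_ h0_uniq] hh' A y; rewrite (h0_uniq h hh') (h0_uniq h') //.
Qed.

(** Translating the induced function by a scalar and dividing by the expected
    factor gives another function on Y that induces f; by uniqueness the two
    are equal. *)
Lemma descent (f : global_functions X) (d : int) :
  Defs.invariant act f ->
  (forall (A : comAlgType k) (s : Gm A) (x : X A), f A (gX s x) = gm_pow s d * f A x) ->
  exists h : global_functions Y,
    (forall A x, h A (pi A x) = f A x) /\ has_weight rho d h.
Proof.
move=> f_inv f_weight; case: (pi_quot) => _ _ /(_ _ f (A1_scheme k) f_inv) [h [hf _]].
exists h; split=> //; apply: has_weight_scalars => c c0.
pose hc (A : comAlgType k) (y : Y A) : A1 k A :=
  gm_pow (scalar_gm A c0) (- d) * h A (rho A (scalar_gm A c0) y).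
have hc_nat (A B : comAlgType k) (g : {lrmorphism A -> B}) (y : Y A) :
    hc B (kmap g y) = kmap g (hc A y).
  rewrite /= /A1_fmap /hc rmorphM gm_pow_map gm_map_scalar /=; congr (_ * _).
  by rewrite function_nat gact_nat gm_map_scalar.
have hcE : forall A y, hc A y = h A y.
  apply: (@pullback_inj (KMor hc_nat) h) => A x /=.
  by rewrite /hc -pi_equiv !hf f_weight mulrA [_ * gm_pow _ d]mulrC gm_powN mul1r.
by move=> A y; rewrite -(hcE A y) /hc mulrA gm_powN mul1r.
Qed.
End Descent.

(** * Weights and the position of the origin *)

Section Constants.
Variables (k : fieldType) (Y : kfunctor k) (c : k).

Lemma constant_nat (A B : comAlgType k) (f : {lrmorphism A -> B}) (y : Y A) :
  (c%:A : A1 k B) = kmap f (c%:A : A1 k A).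
Proof. by rewrite /= /A1_fmap linearZ /= rmorph1. Qed.

Definition constant_function : global_functions Y := KMor constant_nat.
End Constants.

Lemma zonotope_nonempty (R : realType) (n : nat) (E : finType)
    (a : E -> 'rV[int]_n) (u : E -> sign) : exists x : 'rV[R]_n, zonotope a u x.
Proof.
pose c e : R := match u e with SPos => 1 | SNeg => -1 | SZero => 0 end.
exists (\sum_e c e *: toNR R (a e)); exists c; split=> // e.
by rewrite /c; case: (u e) => //; rewrite oppr_le0 ler01.
Qed.

Lemma spanning_pairing (R : realType) (n : nat) (E : finType)
    (a : E -> 'rV[int]_n) (m : 'cV[int]_n) :
  primitive_spanning R a -> m <> 0 -> exists e, pairing m (a e) != 0.
Proof.
move=> [_ a_span] m0; apply: contrapT => no_e; apply: m0; apply/colP => j.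
have [c cj] := a_span (toNR R (delta_mx 0 j)).
have := real_pairing_comb (R := R) m (fun=> 1) (fun _ : 'I_1 => delta_mx 0 j).
rewrite !big_ord1 scale1r mul1r cj real_pairing_comb big1 => [|e _]; last first.
  have [->|ne] := eqVneq (pairing m (a e)) 0; first by rewrite mulr0.
  by case: no_e; exists e.
move=> /esym/eqP; rewrite intr_eq0 => /eqP; rewrite mxE => <-.
rewrite pairingE (bigD1 j) //= mxE !eqxx mul1r big1 ?addr0 // => i /negPf.
by rewrite mxE => ->; rewrite andbF mul0r.
Qed.

(** The torus coordinate e0 rescales the monomial by a nontrivial power. *)
Lemma monomial_nonconstant (k : closedFieldType) (n : nat) (E : finType)
    (a : E -> 'rV[int]_n) (u : E -> sign)
    (M : set (option (zero_part u) -> sign)) (m : 'cV[int]_n) (c : k)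
    (x : XM k a M k^o) e0 :
  pairing m (a e0) != 0 -> @monomial_function k n E a u M m k^o x != 0 :> k ->
  ~ (forall x : XM k a M k^o, @monomial_function k n E a u M m k^o x = c).
Proof.
move=> q0 x0 fc; have [z] := closed_field_infinite [:: 0; 1 : k].
rewrite !inE negb_or => /andP[z0 z1].
have [|r rz] := @exists_root k z (absz (pairing m (a e0))); first by rewrite absz_gt0.
have r0 : r != 0 by apply: contra_neq z0 => r0; rewrite -rz r0 expr0n absz_eq0 (negPf q0).
pose t e : Gm k^o := if e == e0 then field_gm r0 else gm1 k^o.
have tE : torus_hom a t m = r ^ pairing m (a e0).
  rewrite /torus_hom (bigD1 e0) //= /t eqxx field_gm_pow big1 ?mulr1 // => e /negPf ->.
  exact: gm_pow1.
have := monomial_function_act m t (gm1 k^o) x.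
rewrite gm_pow1 mul1r tE !fc -[RHS]mulr1; rewrite (fc x) in x0.
move=> /(mulfI x0) rq1.
apply: (negP z1); rewrite -rz.
case: (pairing m (a e0)) rq1 => p /eqP; first by [].
by rewrite -[r ^ _]/((r ^+ p.+1)^-1) invr_eq1.
Qed.

Theorem corollary5p5 (k : closedFieldType) (R : realType) (n : nat)
    (Z : set 'rV[R]_n) (T : set (set 'rV[R]_n))
    (Z_zonotope : integral_zonotope Z) (T_tiling : tiling Z T)
    (Y : kfunctor k) (rho : gm_action Y) (Y_of_T : is_Y_of_tiling Z T rho) :
  (nonneg_weights rho <-> Z 0) /\
  (positive_weights rho <-> interior Z 0).
Proof.
have [E [a [u [M [a_ps ZE _ TE [pi [pi_quot pi_equiv]]]]]]] := Y_of_T.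
have a_prim := a_ps.1.
have tile x : Z x -> exists2 w, positive_part M w & zonotope a (hat w) x.
  rewrite (tiling_cover T_tiling) TE => -[_ [w Mw <-] wx].
  by exists w.
have [w0 Mw0] : exists w, positive_part M w.
  have [x Zx] := zonotope_nonempty R a u.
  by have [|w Mw _] := tile x; [rewrite ZE | exists w].
have [y0 y0P] := exists_ell_neq0 k a_prim.
have g0 : generic a (fun=> 1 : k) y0 by split=> // e; exact: oner_neq0.
pose x0 := torus_XM Mw0 g0.
have mono_neq0 m : @monomial_function k n E a u M m k^o x0 != 0 :> k.
  exact: (monomial_generic_neq0 m g0).
have mono_descent m := descent pi_quot (gX := @XM_Gmact k n E a u M) pi_equiv
  (monomial_invariant m) (fun A s x => monomial_weight m s x).
have pull_inv (h : global_functions Y) : Defs.invariant (@XM_Kact k n E a u M) (pullback pi h).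
  by case: pi_quot => _ pi_inv _ A t x /=; rewrite pi_inv.
have pull_weight d (h : global_functions Y) : has_weight rho d h ->
    forall (A : comAlgType k) (s : Gm A) (x : XM k a M A),
      pullback pi h A (XM_Gmact s x) = gm_pow s d * pullback pi h A x.
  by move=> hd A s x; rewrite -[LHS]/(h A (pi A (XM_Gmact s x))) pi_equiv; exact: hd.
have pull_const (h : global_functions Y) c :
    (forall A x, pullback pi h A x = c%:A) -> forall A y, h A y = c%:A.
  move=> hc A y; exact: (pullback_inj pi_quot (h' := constant_function Y c)).
(* both directions of the first equivalence are used in the second *)
have nonneg : nonneg_weights rho <-> Z 0.
  split=> [nonneg|Z0 d d0 h hd].
    apply: contrapT; rewrite ZE => /not_zonotope0_functional [m m0].
    have [h [hf hm]] := mono_descent m.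
    by have := mono_neq0 m; rewrite -hf (nonneg _ m0 h hm) eqxx.
  have [w Mw /zonotope0_relation [c [D [D0 cw c0]]]] := tile 0 Z0.
  move=> A y; rewrite -(scale0r 1); apply: pull_const => B x; rewrite scale0r.
  exact: (negative_weight_vanish a_prim (pull_inv h) (pull_weight d h hd) Mw D0 cw c0 d0).
split=> //; split=> [[nonneg' const]|Zint].
  have Z0 : Z 0 by apply/nonneg.
  move: (Z0); rewrite ZE => /interior_or_functional [//|[m [m0 m_le0]]].
  have [h [hf hm]] := mono_descent m.
  move: m_le0; rewrite le_eqVlt => /orP[/eqP m_eq0|m_lt0]; last first.
    by have := mono_neq0 m; rewrite -hf (nonneg' _ m_lt0 h hm) eqxx.
  rewrite m_eq0 in hm; have [c hc] := const h hm.
  have [e e0] := spanning_pairing a_ps m0.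
  case: (monomial_nonconstant (c := c) e0 (mono_neq0 m)) => x.
  by rewrite -hf hc [c%:A]mulr1.
have Z0 : Z 0 by exact: interior_subset Zint.
split=> [|h hd]; first exact/nonneg.
have rays e b : exists (w : zero_part u -> sign) (c : E -> int) (D N : int),
    [/\ positive_part M w, 0 < N, 0 <= D, forall e, within (hat w e) D (c e)
      & \sum_e c e *: a e = N *: ((-1) ^+ b *: a e)].
  have [|eps [eps0 Zeps]] := @interior_ray R n E a u ((-1) ^+ b *: a e); first by rewrite -ZE.
  have [|w Mw /(zonotope_ray_relation eps0)] := tile (eps *: toNR R ((-1) ^+ b *: a e)).
    by rewrite ZE.
  by move=> [c [D [N [N0 D0 cw cN]]]]; exists w, c, D, N.
have [c hc] := weight_zero_constant a_prim (pull_inv h) (pull_weight 0 h hd) Mw0 erefl rays.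
by exists c; apply: pull_const.
Qed.
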